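(* Let $S=K[x_1,\ldots,x_n]$ be a polynomial ring over a field $K$, let $d\geq 2$, and let $u,v\in S$ be monomials of degree $d$ with $u>_{lex}v$, $x_1\mid u$ and $x_1\nmid v$. Assume that the lexsegment ideal $I=(\mathcal{L}(u,v))\subset S$ has linear quotients with respect to the increasing reverse lexicographical order and is not a completely lexsegment ideal. Let $k\geq 1$ and let $\mathbb{F}_{\bullet}$ be the graded minimal free resolution of $S/I^k$, where $F_0=S$ and, for $i\geq1$, $F_i$ is the free $S$-module with homogeneous basis the symbols $f(\sigma;w)$ with $w\in G(I^k)$, $\sigma\subseteq\mathrm{set}(w)$, $|\sigma|=i-1$, and $\deg f(\sigma;w)=|\sigma|+\deg(w)$. Then the chain map $\partial$ of $\mathbb{F}_{\bullet}$ is given by $$\partial(f(\sigma; w)) = \sum_{\substack{s\in\sigma\\ x_sw/x_{\min(w)}\succeq v^k}}(-1)^{\alpha(\sigma;s)}x_{\min(w)}f\left(\sigma\setminus \{s\};\frac{x_sw}{x_{\min(w)}}\right)+\sum_{\substack{s\in\sigma\\ x_sw/x_{\min(w)}\prec v^k}}(-1)^{\alpha(\sigma;s)}x_{\min(\tilde{w})}f\left(\sigma\setminus \{s\};\frac{x_sw}{x_{\min(\tilde{w})}}\right)-\sum_{s\in\sigma}(-1)^{\alpha(\sigma;s)}x_sf(\sigma\setminus \{s\};w)$$ if $\sigma\neq\emptyset$, and $\partial(f(\emptyset; w)) = w$ otherwise. Here $\alpha(\sigma;s)=|\{t\in\sigma : t<s\}|$, and by convention $f(\sigma;w)=0$ if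 $\sigma\nsubseteq\mathrm{set}(w)$.
   Context: $<_{lex}$ is the lexicographical order with $x_1>_{lex}\cdots>_{lex}x_n$. For monomials $u\geq_{lex}v$ of degree $d$, $\mathcal{L}(u,v)$ is the set of all monomials $w$ of degree $d$ with $u\geq_{lex}w\geq_{lex}v$; such a set is called a lexsegment set, and $(\mathcal{L}(u,v))$, the ideal it generates, a lexsegment ideal. For a set $T$ of monomials, $\mathrm{Shad}(T)=\{x_iw : 1\leq i\leq n,\ w\in T\}$ and $\mathrm{Shad}^i(T)=\mathrm{Shad}^{i-1}(\mathrm{Shad}(T))$. A lexsegment set is completely lexsegment if all its iterated shadows are again lexsegment sets; the ideal it generates is then called a completely lexsegment ideal. For a monomial $m$, $\nu_i(m)$ is the exponent of $x_i$ in $m$, and $\min(m)$ is the smallest $i$ with $\nu_i(m)\neq0$. For monomials of the same degree, $m_1<_{revlex}m_2$ if there is some $s$ with $\nu_i(m_1)=\nu_i(m_2)$ for all $i>s$ and $\nu_s(m_1)>\nu_s(m_2)$. For a monomial ideal $J$, $G(J)$ is its set of minimal monomial generators. $J$ has linear quotients with respect to an ordering $m_1,\ldots,m_r$ of $G(J)$ if $(m_1,\ldots,m_{i-1}):(m_i)$ is generated by a set of variables for all $i\geq 2$; then $\mathrm{set}(m_i)=\{j : x_j\in(m_1,\ldots,m_{i-1}):(m_i)\}$ (with $\mathrm{set}(m_1)=\emptyset$). It is known that, under the hypotheses of the claim, $u=x_1x_{l+1}^{a_{l+1}}\cdots x_n^{a_n}$ and $v=x_lx_n^{d-1}$ for some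 (unique) $l$ with $2\leq l\leq n-1$, and that $I^k$ has linear quotients with respect to the increasing reverse lexicographical order of $G(I^k)$ (generators listed so that $m_1<_{revlex}m_2<_{revlex}\cdots$), for every $k\geq1$. The sets $\mathrm{set}(w)$, $w\in G(I^k)$, are taken with respect to this order. For this $l$, every monomial $m\in S$ is written uniquely as $m=\overline{m}\,\tilde{m}$ with $\overline{m}\in K[x_1,\ldots,x_l]$ and $\tilde{m}\in K[x_{l+1},\ldots,x_n]$. On monomials of degree $kd$: $m_1\prec m_2$ if $\deg(\overline{m_1})<\deg(\overline{m_2})$, or $\deg(\overline{m_1})=\deg(\overline{m_2})$ and $m_1<_{lex}m_2$; and $m_1\succeq m_2$ means $m_2\prec m_1$ or $m_1=m_2$. The basis $f(\sigma;w)$ is the one coming from the Herzog–Takayama iterated mapping cone construction: with $G(I^k)=\{m_1,\ldots,m_r\}$ listed in the increasing reverse lexicographical order, that is, $m_1<_{revlex}m_2<_{revlex}\cdots<_{revlex}m_r$, and $I_j=(m_1,\ldots,m_j)$, a resolution of $S/I_j$ is the mapping cone of a comparison map lifting $S/(I_{j-1}:m_j)\xrightarrow{\ m_j\ }S/I_{j-1}$ from the Koszul complex on $\{x_i : i\in\mathrm{set}(m_j)\}$ to the resolution of $S/I_{j-1}$; $f(\sigma;m_j)$ denotes the basis element corresponding to the Koszul basis element indexed by $\sigma\subseteq\mathrm{set}(m_j)$. It is known that the resulting complex is a minimal graded free resolution of $S/I^k$. *)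

(* Defs.v *)
From HB Require Import structures.
From mathcomp Require Import all_boot all_order all_algebra.
From mathcomp Require Import boolp.
From mathcomp Require Import mpoly.

Set Implicit Arguments.
Unset Strict Implicit.
Unset Printing Implicit Defensive.

Import GRing.Theory.
Local Open Scope ring_scope.

(* The variables x_1, ..., x_n are indexed from 0: x_1 is 'X_ord0, and the    *)
(* monomial with exponent vector m : 'X_{1..n} is 'X_[m].                     *)

Section Monomials.
Variable n : nat.
Implicit Types (m u v w : 'X_{1..n}) (T : 'X_{1..n} -> Prop).

Definition lexlt m1 m2 : bool :=
  [exists s : 'I_n,
     [forall i : 'I_n, (i < s)%N ==> (m1 i == m2 i)] && (m1 s < m2 s)%N].

Definition lexle m1 m2 : bool := (m1 == m2) || lexlt m1 m2.

Definition revlexlt m1 m2 : bool :=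
  [exists s : 'I_n,
     [forall i : 'I_n, (s < i)%N ==> (m1 i == m2 i)] && (m2 s < m1 s)%N].

Definition lexseg u v w : Prop := [/\ mdeg w = mdeg u, lexle w u & lexle v w].

Definition lexsegment_set T : Prop :=
  exists u v, [/\ mdeg u = mdeg v, lexle v u & forall w, T w <-> lexseg u v w].

Definition shad T w : Prop := exists i m, T m /\ w = (U_(i) + m)%MM.

Definition completely_lexsegment_set T : Prop :=
  lexsegment_set T /\ forall i, lexsegment_set (iter i shad T).

(* m = headm l m + tailm l m, the splitting into the variables of index at    *)
(* most l and those of index greater than l.                                  *)
Definition headm (l : 'I_n) m : 'X_{1..n} :=
  [multinom (if (i <= l)%N then m i else 0%N) | i < n].
Definition tailm (l : 'I_n) m : 'X_{1..n} :=
  [multinom (if (l < i)%N then m i else 0%N) | i < n].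

Definition prec (l : 'I_n) m1 m2 : bool :=
  (mdeg (headm l m1) < mdeg (headm l m2))%N
  || (mdeg (headm l m1) == mdeg (headm l m2)) && lexlt m1 m2.

Definition succeq (l : 'I_n) m1 m2 : bool := prec l m2 m1 || (m1 == m2).

Definition alpha (sigma : {set 'I_n}) (s : 'I_n) : nat :=
  #|[set t in sigma | (t < s)%N]|.

End Monomials.

(* Junk value ord0 when m = 1. *)
Definition minvar (n : nat) (m : 'X_{1..n.+1}) : 'I_n.+1 :=
  odflt ord0 [pick i : 'I_n.+1 |
    (m i != 0%N) && [forall j : 'I_n.+1, (j < i)%N ==> (m j == 0%N)]].

Section Ideals.
Variables (K : fieldType) (n : nat).
Local Notation S := {mpoly K[n]}.
Implicit Types (I J P : S -> Prop) (ms : seq 'X_{1..n}).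

Definition ideal_gen P : S -> Prop := fun p =>
  exists r : seq (S * S),
    (forall c, c \in r -> P c.2) /\ p = \sum_(c <- r) c.1 * c.2.

Definition mon_ideal (T : 'X_{1..n} -> Prop) : S -> Prop :=
  ideal_gen (fun p => exists2 m, T m & p = 'X_[m]).

Definition ideal_pow J (k : nat) : S -> Prop :=
  ideal_gen (fun p => exists fs : k.-tuple S,
    (forall f, f \in fs -> J f) /\ p = \prod_(f <- fs) f).

Definition colon J (f : S) : S -> Prop := fun p => J (p * f).

Definition completely_lexsegment_ideal J : Prop :=
  exists T, completely_lexsegment_set T /\ forall p, J p <-> mon_ideal T p.

Definition mingen J (m : 'X_{1..n}) : Prop :=
  J 'X_[m] /\ forall m', (m' <= m)%MM -> J 'X_[m'] -> m' = m.

(* The colon ideal (m_1, ..., m_{a-1}) : (m_a), positions in ms being counted *)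
(* from 0.                                                                    *)
Definition lqcolon ms (a : 'I_(size ms)) : S -> Prop :=
  colon (mon_ideal (fun m => m \in take a ms)) 'X_[tnth (in_tuple ms) a].

Definition linear_quotients ms : Prop :=
  forall a : 'I_(size ms), (0 < a)%N ->
    exists A : {set 'I_n}, forall p,
      lqcolon a p <-> ideal_gen (fun q => exists2 j, j \in A & q = 'X_j) p.

Definition lqset ms (a : 'I_(size ms)) : {set 'I_n} :=
  [set j | `[< lqcolon a 'X_j >]].

Definition revlex_listing J ms : Prop :=
  sorted (@revlexlt n) ms /\ forall m, m \in ms <-> mingen J m.

Definition revlex_linear_quotients J : Prop :=
  exists ms, revlex_listing J ms /\ linear_quotients ms.

(* {mpoly K[n]}^o makes S a module over itself (by default it is a K-module). *)
Definition freeS (B : finType) := {ffun B -> S^o}.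

Definition fbase (B : finType) (b : B) : freeS B := [ffun b' => (b' == b)%:R].

Section Resolutions.
Variables (B : nat -> finType) (deg : forall i, B i -> nat).
Variable d : forall i, {linear freeS (B i.+1) -> freeS (B i)}.

(* F_i = freeS (B i); the first two conditions say F_0 = S and F_0 / im = S/J *)
Definition minimal_graded_free_resolution J : Prop :=
  [/\ #|B 0%N| = 1%N /\ (forall b : B 0%N, deg b = 0%N),
      forall p, J p <-> exists x, d 0%N x = [ffun=> p],
      forall i x, d i x = 0 <-> exists y, x = d i.+1 y,
      forall i (b : B i.+1) (b' : B i) m,
        m \in msupp (d i (fbase b) b' : S) -> deg b = (mdeg m + deg b')%N
    & forall i x (b' : B i), (d i x b' : S)@_0%MM = 0].

End Resolutions.

Section Koszul.
Variable A : {set 'I_n}.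

Definition kbasis (i : nat) : finType :=
  {sigma : {set 'I_n} | (sigma \subset A) && (#|sigma| == i)}.

Definition ksym (i : nat) (sigma : {set 'I_n}) : freeS (kbasis i) :=
  [ffun b => (val b == sigma)%:R].

Definition kdiff (i : nat) (x : freeS (kbasis i.+1)) : freeS (kbasis i) :=
  \sum_b x b *: \sum_(s in val b)
    (((-1) ^+ alpha (val b) s * 'X_s : S) *: ksym i (val b :\ s)).

End Koszul.

Section MappingCone.
Variable ms : seq 'X_{1..n}.

(* The pair (a, sigma) stands for the symbol f(sigma; m_a). *)
Definition symbol (i : nat) : finType :=
  {p : 'I_(size ms) * {set 'I_n} | (p.2 \subset lqset p.1) && (#|p.2| == i)}.

Definition sgen (i : nat) (b : symbol i) : 'X_{1..n} :=
  tnth (in_tuple ms) (val b).1.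

Definition Fbasis (i : nat) : finType := if i is j.+1 then symbol j else unit.

Definition Fdeg (i : nat) : Fbasis i -> nat :=
  match i with
  | 0 => fun _ => 0%N
  | j.+1 => fun b : symbol j => (#|(val b).2| + mdeg (sgen b))%N
  end.

(* Number of generators after which a basis element is available: the basis   *)
(* of the resolution of S/(m_1, ..., m_j) is given by stage <= j.             *)
Definition stage (i : nat) : Fbasis i -> nat :=
  match i with
  | 0 => fun _ => 0%N
  | j.+1 => fun b : symbol j => ((val b).1).+1
  end.

(* f(sigma; w) in F_{i+1}, for |sigma| = i; it is 0 if there is no such       *)
(* symbol, in particular if sigma is not contained in set(w).                 *)
Definition fsymb (i : nat) (sigma : {set 'I_n}) (w : 'X_{1..n}) :
    freeS (Fbasis i.+1) :=
  [ffun b : symbol i => (((val b).2 == sigma) && (sgen b == w))%:R].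

Variable d : forall i, {linear freeS (Fbasis i.+1) -> freeS (Fbasis i)}.

Section Step.
Variable a : 'I_(size ms).
Let m := tnth (in_tuple ms) a.
Let A := lqset a.

Definition kincl (i : nat) (x : freeS (kbasis A i)) : freeS (Fbasis i.+1) :=
  \sum_b x b *: fsymb i (val b) m.

(* psi is a comparison map from the Koszul complex on {x_j : j in set(m_a)}   *)
(* to the complex F^(a) built from the generators preceding m_a, and it lifts *)
(* the multiplication by m_a.                                                 *)
Definition comparison_map
    (psi : forall i, {linear freeS (kbasis A i) -> freeS (Fbasis i)}) : Prop :=
  [/\ forall i x (b : Fbasis i), psi i x b != 0 -> (stage b <= a)%N,
      psi 0%N (ksym A 0 set0) = [ffun=> 'X_[m]]
    & forall i x, d i (psi i.+1 x) = psi i (kdiff x)].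

(* The next complex is K[-1] (+) F^(a), K being embedded by kincl, with       *)
(* differential (x, y) |-> (- kdiff x, psi x + d y).                          *)
Definition mapping_cone
    (psi : forall i, {linear freeS (kbasis A i) -> freeS (Fbasis i)}) : Prop :=
  (forall x, d 0%N (kincl x) = psi 0%N x) /\
  (forall i x, d i.+1 (kincl x) = psi i.+1 x - kincl (kdiff x)).

End Step.

Definition iterated_mapping_cone : Prop :=
  forall a : 'I_(size ms), exists psi,
    comparison_map (a := a) psi /\ mapping_cone (a := a) psi.

End MappingCone.

End Ideals.

(* Main.v *)
Require Import Defs.
From HB Require Import structures.
From mathcomp Require Import all_boot all_order all_algebra.
From mathcomp Require Import boolp.
From mathcomp Require Import mpoly.
From mathcomp Require Import zify ring.

Set Implicit Arguments.
Unset Strict Implicit.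
Unset Printing Implicit Defensive.

Import GRing.Theory.
Local Open Scope ring_scope.

(* Let (m_1, ..., m_r) be a list of monomials with linear quotients, and let  *)
(* g(M) be the first m_b dividing M. If set(g(x_s w)) is contained in set(w)  *)
(* for all w and all s in set(w), then g(x_t g(x_s w)) = g(x_s g(x_t w)), and *)
(* f(sigma; w) |-> sum +- ((x_s w / g(x_s w)) f(sigma - s; g(x_s w))          *)
(*                         - x_s f(sigma - s; w))                             *)
(* is a differential; it is the iterated mapping cone, and it is exact by     *)
(* induction on the last generator involved, the top part of a cycle being a  *)
(* Koszul cycle (Herzog and Takayama).                                        *)
(* In the case at hand, if L(u,v) has linear quotients then v has no          *)
(* predecessor in the reverse lexicographical order, which forces             *)
(* v = x_l x_n^(d-1), and the failure of the De Negri-Herzog criterion for    *)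
(* completely lexsegment ideals gives the shape of u. With h the degree in    *)
(* x_1, ..., x_l, the generators w of I^k satisfy h(w) >= k and are stable    *)
(* under w |-> x_s w / x_t for t < s as long as h stays >= k. Hence g(x_s w)  *)
(* is x_s w / x_t for the smallest such t, and v^k <= w in the order of the   *)
(* statement means exactly h(w) >= k.                                         *)

(** * Monomial ideals *)

(** A general principle on monomial ideals is separated from the combinatorics of the powers of I.
    Let g(x_s w) be the first generator dividing x_s w. If set(w) never grows under w |-> g(x_s w),
    then applying g with x_s and x_t in either order gives the same generator ([decompC], [cofacC]).
    The terms of the square of the explicit map [del] are then symmetric in s and t while the signs
    are antisymmetric, so [del] is a differential. Exactness ([del_exact]) goes by induction along
    the list: the part of a cycle on its last generator w is a Koszul cycle on the variables of
    set(w), hence a Koszul boundary ([koszul_exact]), and correcting by a boundary leaves only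
    earlier generators.

    It remains to compute g for I^k. [lexseg_shape] determines u and v. Call the degree in x_1, ...,
    x_l the head degree. Every generator of I^k has head degree at least k ([prodset_hdeg]), and as
    long as this bound is kept, x_t may be replaced by x_s with t < s ([prodset_move]). From this
    follow linear quotients ([nth_lq]), the regularity of g ([nth_reg]) and g(x_s w) = x_s w / x_t
    for the least allowed t ([decomp_min_admissible]). By [succeqE], comparing with v^k means
    comparing the head degree with k. If x_min(w) can be removed within the bound, it is the least
    choice; otherwise no head variable can be removed, and the least choice is the first variable of
    the tail. *)

Section MonomialIdeals.
Variables (K : fieldType) (n : nat).
Local Notation S := {mpoly K[n]}.
Implicit Types (p q : S) (m t : 'X_{1..n}) (T : 'X_{1..n} -> Prop).

Lemma ideal_gen_lin (P Q : S -> Prop) p :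
    Q 0 -> (forall a b, Q a -> Q b -> Q (a + b)) ->
    (forall c a, P a -> Q (c * a)) ->
  ideal_gen P p -> Q p.
Proof.
move=> Q0 QD QM [r [rP ->]]; elim: r rP => [|c r IH] rP; first by rewrite big_nil.
rewrite big_cons; apply: QD; first by apply: QM; apply: rP; rewrite mem_head.
by apply: IH => c' c'r; apply: rP; rewrite inE c'r orbT.
Qed.

Lemma ideal_gen0 (P : S -> Prop) : ideal_gen P 0.
Proof. by exists [::]; split=> //; rewrite big_nil. Qed.

Lemma ideal_genD (P : S -> Prop) p q :
  ideal_gen P p -> ideal_gen P q -> ideal_gen P (p + q).
Proof.
move=> [r [rP ->]] [s [sP ->]]; exists (r ++ s); split; last by rewrite big_cat.
by move=> c; rewrite mem_cat => /orP[/rP|/sP].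
Qed.

Lemma ideal_genM (P : S -> Prop) c p : P p -> ideal_gen P (c * p).
Proof.
move=> Pp; exists [:: (c, p)]; split; last by rewrite big_seq1.
by move=> x; rewrite inE => /eqP->.
Qed.

(** The support condition survives sums and multiples; conversely a polynomial is the sum of its
    terms, each a multiple of a generator. *)
Lemma mon_idealP T p :
  mon_ideal T p <-> forall m, m \in msupp p -> exists2 t, T t & (t <= m)%MM.
Proof.
split.
  move=> pT; pattern p; apply: (ideal_gen_lin _ _ _ pT) => {p pT} [m|a b aP bP m|c a [t Tt ->] m].
  - by rewrite msupp0.
  - by move=> /msuppD_le; rewrite mem_cat => /orP[/aP|/bP].
  - move=> /msuppM_le/allpairsP[[m1 m2] /= [_ m2P ->]]; exists t => //.
    by rewrite (mem_msuppXP _ _ _ m2P) lem_addl.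
move=> pP; rewrite [p]mpolyE big_seq.
apply: big_ind => [|a b|m /pP[t Tt le_tm]]; [exact: ideal_gen0|exact: ideal_genD|].
rewrite -(submK le_tm) mpolyXD scalerAl; apply: ideal_genM; by exists t.
Qed.

Lemma mon_idealX T m : mon_ideal T 'X_[K, m] <-> exists2 t, T t & (t <= m)%MM.
Proof.
split=> [/mon_idealP|[t Tt tm]]; first by apply; apply/mem_msuppXP.
by apply/mon_idealP => m' /mem_msuppXP <-; exists t.
Qed.

Lemma eq_mon_ideal T T' p :
  (forall m, T m <-> T' m) -> mon_ideal T p <-> mon_ideal T' p.
Proof.
by move=> TT'; split=> /mon_idealP pP; apply/mon_idealP => m /pP[t Tt tm];
   exists t => //; apply/TT'.
Qed.

Definition varset (A : {set 'I_n}) m := exists2 j, j \in A & m = U_(j)%MM.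

Lemma mon_ideal_varset (A : {set 'I_n}) p :
  ideal_gen (fun q => exists2 j, j \in A & q = 'X_j) p <-> mon_ideal (varset A) p.
Proof.
split=> pI; pattern p; apply: (ideal_gen_lin _ _ _ pI).
- exact: ideal_gen0.
- by move=> a b; exact: ideal_genD.
- by move=> c a [j jA ->]; apply: ideal_genM; exists U_(j)%MM => //; exists j.
- exact: ideal_gen0.
- by move=> a b; exact: ideal_genD.
- by move=> c a [_ [j jA ->] ->]; apply: ideal_genM; exists j.
Qed.

Lemma varsetP (A : {set 'I_n}) p :
  mon_ideal (varset A) p <-> exists c : 'I_n -> S, p = \sum_(j in A) c j * 'X_j.
Proof.
split=> [|[c ->]]; last first.
  apply: big_ind => [|a b|j jA]; [exact: ideal_gen0|exact: ideal_genD|].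
  by apply: ideal_genM; exists U_(j)%MM => //; exists j.
move=> pI; pattern p; apply: (ideal_gen_lin _ _ _ pI) => {p pI} [|a b [ca ->] [cb ->]|c _ [_ [j jA ->] ->]].
- by exists (fun=> 0); rewrite big1 // => j _; rewrite mul0r.
- exists (fun j => ca j + cb j); rewrite -big_split /=.
  by apply: eq_bigr => j _; rewrite mulrDl.
- exists (fun i => if i == j then c else 0); rewrite (bigD1 j) //= eqxx.
  by rewrite big1 ?addr0 // => i /andP[_ /negPf->]; rewrite mul0r.
Qed.

(** Between monomials of equal degree divisibility is equality, so no generator is redundant. *)
Lemma mingen_equigenerated T D :
    (forall m, T m -> mdeg m = D) ->
  forall m, mingen (mon_ideal T : S -> Prop) m <-> T m.
Proof.
move=> degT m; split=> [[/mon_idealX[t Tt tm] /(_ t tm) <- //]|Tm].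
  by apply/mon_idealX; exists t; rewrite ?lepm_refl.
split; first by apply/mon_idealX; exists m; rewrite ?lepm_refl.
move=> m' le_m' /mon_idealX[t Tt tm'].
have: mdeg (m - m')%MM == 0%N.
  have := congr1 (@mdeg n) (submK le_m'); rewrite mdegD (degT _ Tm) => e.
  have := congr1 (@mdeg n) (submK tm'); rewrite mdegD (degT _ Tt) => e'.
  by lia.
by rewrite mdeg_eq0 => /eqP m0; rewrite -(submK le_m') m0 add0m.
Qed.

Fixpoint prodset T k m : Prop :=
  if k is k'.+1 then exists m1 m2, [/\ T m1, prodset T k' m2 & m = (m1 + m2)%MM]
  else m = 0%MM.

Lemma prodset_deg T D k m :
  (forall m, T m -> mdeg m = D) -> prodset T k m -> mdeg m = (k * D)%N.
Proof.
move=> degT; elim: k m => [|k IH] m /=; first by move->; rewrite mdeg0.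
by move=> [m1 [m2 [/degT d1 /IH d2 ->]]]; rewrite mdegD d1 d2 mulSn.
Qed.

Lemma ideal_pow_mon T k p :
  ideal_pow (mon_ideal T) k p <-> mon_ideal (prodset T k) p.
Proof.
split; last first.
  move=> pI; pattern p; apply: (ideal_gen_lin _ _ _ pI) => {p pI} [|a b|c _ [m Tm ->]];
    [exact: ideal_gen0|exact: ideal_genD|].
  apply: ideal_genM; elim: k m Tm => [|k IH] m /=.
    by move->; exists [tuple]; split=> //; rewrite big_nil mpolyX0.
  move=> [m1 [m2 [T1 /IH[fs [fsP e2]] ->]]]; exists [tuple of 'X_[m1] :: fs].
  split; last by rewrite big_cons mpolyXD e2.
  move=> f; rewrite inE => /orP[/eqP->|/fsP //].
  by apply/mon_idealX; exists m1; rewrite ?lepm_refl.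
move=> pI; pattern p; apply: (ideal_gen_lin _ _ _ pI) => {p pI} [|a b|c _ [fs [fsP ->]]];
  [exact: ideal_gen0|exact: ideal_genD|].
suff: mon_ideal (prodset T k) (\prod_(f <- fs) f : S).
  move=> /mon_idealP P; apply/mon_idealP => m /msuppM_le/allpairsP[[a b] /= [_]].
  by move=> /P[t Tt tb] ->; exists t => //; apply: lepm_trans tb (lem_addl _ _).
elim: k fs fsP => [|k IH] fs fsP.
  by rewrite tuple0 big_nil -mpolyX0; apply/mon_idealX; exists 0%MM; rewrite ?lepm_refl.
case/tupleP: fs fsP => f fs fsP; rewrite big_cons; apply/mon_idealP => m.
move=> /msuppM_le/allpairsP[[a b] /= [aP bP ->]].
have /mon_idealP/(_ a aP)[t1 T1 le1] : mon_ideal T f by apply: fsP; rewrite mem_head.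
have /mon_idealP/(_ b bP)[t2 T2 le2]: mon_ideal (prodset T k) (\prod_(f <- fs) f : S).
  by apply: IH => g gP; apply: fsP; rewrite inE gP orbT.
exists (t1 + t2)%MM; first by exists t1, t2.
by apply/mnm_lepP => i; rewrite !mnmDE leq_add // (mnm_lepP _).
Qed.

End MonomialIdeals.

(** * Koszul complexes *)

Section Koszul.
Variables (K : fieldType) (n : nat).
Local Notation S := {mpoly K[n]}.
Implicit Types (s t : 'I_n) (A sigma tau : {set 'I_n}) (x y : {set 'I_n} -> S).

(** The terms for (s,t) and (t,s) cancel in pairs; every proof below that a differential squares to
    zero rests on this. *)
Lemma sum_antisym (V : zmodType) A (F : 'I_n -> 'I_n -> V) :
    (forall s t, s \in A -> t \in A -> (t < s)%N -> F s t + F t s = 0) ->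
  \sum_(s in A) \sum_(t in A :\ s) F s t = 0.
Proof.
move=> F0.
rewrite (eq_bigr (fun s => \sum_(t in A | (t < s)%N) F s t
    + \sum_(t in A | (s < t)%N) F s t)) => [|s sA].
  rewrite big_split /=.
  have -> : \sum_(s in A) \sum_(t in A | (s < t)%N) F s t
      = \sum_(s in A) \sum_(t in A | (t < s)%N) F t s.
    rewrite (exchange_big_dep (fun t => t \in A)) => [|s t _ /andP[]//].
    by apply: eq_bigr => t tA; apply: eq_bigl => s; rewrite tA.
  rewrite -big_split; apply: big1 => s sA; rewrite -big_split /=.
  by apply: big1 => t /andP[tA ts]; apply: F0.
rewrite (bigID (fun t => (t < s)%N)) /=; congr (_ + _); apply: eq_bigl => t;
  rewrite !inE; case: (ltngtP t s) => [||/val_inj->]; rewrite ?andbF ?eqxx ?andbT //=.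
- by move=> lt; rewrite -val_eqE ltn_eqF.
- by move=> lt; rewrite -val_eqE gtn_eqF.
Qed.

Lemma alphaU1 s t sigma :
  s \notin sigma -> alpha (s |: sigma) t = ((s < t) + alpha sigma t)%N.
Proof.
move=> sN; rewrite /alpha; case: (ltnP s t) => st.
  rewrite (_ : [set r in s |: sigma | _] = s |: [set r in sigma | (r < t)%N]).
    by rewrite cardsU1 inE (negPf sN).
  by apply/setP => r; rewrite !inE andb_orl; case: eqP => // ->; rewrite st.
rewrite add0n; apply: eq_card => r; rewrite !inE andb_orl.
by case: eqP => // ->; rewrite ltnNge st.
Qed.

Lemma alphaD1 s t sigma :
  s \in sigma -> alpha sigma t = ((s < t) + alpha (sigma :\ s) t)%N.
Proof. by move=> sP; rewrite -{1}(setD1K sP) alphaU1 // !inE eqxx. Qed.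

Lemma sign_alphaD1 (R : pzRingType) s t sigma : t \in sigma -> s \in sigma -> (t < s)%N ->
  (-1) ^+ alpha sigma s * (-1) ^+ alpha (sigma :\ s) t
    = - ((-1) ^+ alpha sigma t * (-1) ^+ alpha (sigma :\ t) s) :> R.
Proof.
move=> tP sP ts; rewrite (alphaD1 s tP) (alphaD1 t sP) ts.
by rewrite ltnNge (ltnW ts) add0n exprD expr1 mulN1r mulNr -!exprD addnC.
Qed.

(* The Koszul differential on the free module with basis all sets e_sigma,    *)
(* read on coordinates: d e_sigma = sum_(s in sigma) +- x_s e_(sigma - s).    *)
Definition koszul x tau : S :=
  \sum_(s | s \notin tau) (-1) ^+ alpha (s |: tau) s * 'X_s * x (s |: tau).

Lemma eq_koszul x y tau :
  (forall s, s \notin tau -> x (s |: tau) = y (s |: tau)) ->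
  koszul x tau = koszul y tau.
Proof. by move=> xy; apply: eq_bigr => s sN; rewrite xy. Qed.

Lemma koszulD x y tau :
  koszul (fun sigma => x sigma + y sigma) tau = koszul x tau + koszul y tau.
Proof. by rewrite -big_split; apply: eq_bigr => s _; rewrite mulrDr. Qed.

Lemma koszulN x tau : koszul (fun sigma => - x sigma) tau = - koszul x tau.
Proof. by rewrite -sumrN; apply: eq_bigr => s _; rewrite mulrN. Qed.

Lemma koszul_eq0 x tau :
  (forall s, s \notin tau -> x (s |: tau) = 0) -> koszul x tau = 0.
Proof. by move=> x0; apply: big1 => s sN; rewrite x0 ?mulr0. Qed.

Lemma koszulK x tau : koszul (koszul x) tau = 0.
Proof.
rewrite /koszul.
under eq_bigr => s sN do rewrite mulr_sumr.
rewrite -[RHS](@sum_antisym _ (~: tau) (fun s t =>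
  (-1) ^+ alpha (s |: tau) s * 'X_s *
  ((-1) ^+ alpha (t |: (s |: tau)) t * 'X_t * x (t |: (s |: tau))))).
  apply: eq_big => [s|s sN]; first by rewrite inE.
  by apply: eq_bigl => t; rewrite !inE negb_or.
move=> s t; rewrite !inE => sN tN ts; rewrite [s |: (t |: _)]setUCA.
set sigma := t |: (s |: tau).
have sP : s \in sigma by rewrite !inE eqxx orbT.
have tP : t \in sigma by rewrite !inE eqxx.
have -> : s |: tau = sigma :\ t.
  by rewrite setU1K // !inE negb_or tN -val_eqE ltn_eqF.
have -> : t |: tau = sigma :\ s.
  by rewrite /sigma setUCA setU1K // !inE negb_or sN -val_eqE gtn_eqF.
have := sign_alphaD1 S tP sP ts.
set a := _ ^+ alpha sigma s; set b := _ ^+ alpha sigma t.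
set c := _ ^+ alpha (sigma :\ s) t; set e := _ ^+ alpha (sigma :\ t) s => E.
transitivity ((a * c + b * e) * ('X_s * 'X_t * x sigma)); first by ring.
by rewrite E addNr mul0r.
Qed.

Definition ksupp A x := forall sigma, ~~ (sigma \subset A) -> x sigma = 0.

Lemma ksupp_koszul A x : ksupp A x -> ksupp A (koszul x).
Proof.
move=> xA tau tauA; apply: koszul_eq0 => s _; apply: xA.
by apply: contra tauA => /subUsetP[].
Qed.

(** The chain of degree one with coefficients c_j; it realises an element of the ideal of variables
    as a boundary. *)
Definition kpoint A (c : 'I_n -> S) sigma : S :=
  \sum_(j in A) (sigma == [set j])%:R * c j.

Lemma ksupp_kpoint A c : ksupp A (kpoint A c).
Proof.
move=> sigma sA; apply: big1 => j jA; case: eqP => [e|]; last by rewrite mul0r.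
by rewrite e sub1set jA in sA.
Qed.

Lemma kpoint0 A c : kpoint A c set0 = 0.
Proof.
by apply: big1 => j _; rewrite eq_sym -cards_eq0 cards1 mul0r.
Qed.

Lemma koszul_kpoint A c tau :
  koszul (kpoint A c) tau = (tau == set0)%:R * \sum_(j in A) c j * 'X_j.
Proof.
case: eqP => [->|/eqP tau0].
  rewrite mul1r [RHS]big_mkcond; apply: eq_big => [s|s _]; first by rewrite inE.
  rewrite setU0 (_ : alpha _ _ = 0%N) ?mul1r; last first.
    by apply/eqP; rewrite cards_eq0; apply/eqP/setP => r; rewrite !inE;
       case: eqP => // ->; rewrite ltnn.
  rewrite /kpoint big_mkcond (bigD1 s) //= eqxx mul1r big1 ?addr0.
    by case: (s \in A); rewrite ?mulr0 // mulrC.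
  by move=> j js; case: (j \in A); rewrite // (inj_eq set1_inj) eq_sym (negPf js) mul0r.
rewrite mul0r; apply: koszul_eq0 => s sN; apply: big1 => j _.
case: eqP => [e|_]; last by rewrite mul0r.
case/set0Pn: tau0 => r rT; have /setP E := e; have := E r; have := E s.
rewrite !inE eqxx rT orbT => /esym/eqP sj /esym/eqP rj.
by rewrite sj -rj rT in sN.
Qed.

(** As s is not in A, a variable of A dividing x_s m already divides m. *)
Lemma varset_regular A s (p : S) :
  s \notin A -> mon_ideal (varset A) ('X_s * p) -> mon_ideal (varset A) p.
Proof.
move=> sA /mon_idealP P; apply/mon_idealP => m mp.
have [|_ [j jA ->] le_j] := P (U_(s) + m)%MM.
  by rewrite mcoeff_msupp mulrC mcoeffMX -mcoeff_msupp.
exists U_(j)%MM; first by exists j.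
move: le_j; rewrite !lep1mP mnmDE mnm1E.
by case: (eqVneq s j) => [e|_]; [rewrite e jA in sA | rewrite add0n].
Qed.

(** Induction on A, splitting off its least element s: a chain is e_s /\ x2 plus a chain free of
    e_s. All degrees are treated at once; vanishing at the empty set discards the homology in degree
    0. *)
Lemma koszul_exact A x :
    ksupp A x -> x set0 = 0 -> (forall tau, koszul x tau = 0) ->
  exists y, [/\ ksupp A y, y set0 = 0 & forall tau, koszul y tau = x tau].
Proof.
have [k] := ubnP #|A|; elim: k A x => // k IH A x cA xA x0 dx.
have [A0|[s0 s0A]] := set_0Vmem A.
  exists (fun=> 0); split=> // tau; rewrite koszul_eq0 //.
  by have [->|/set0Pn[r rT]] := eqVneq tau set0; rewrite ?x0 ?xA //;
    apply/subsetPn; exists r; rewrite // A0 inE.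
have [s sA smin] : exists2 s, s \in A & forall t, t \in A -> (s <= t)%N.
  by case: (arg_minnP (@nat_of_ord n) s0A) => s sA smin; exists s.
have {smin} slt t : t \in A :\ s -> (s < t)%N.
  by rewrite !inE => /andP[ts tA]; rewrite ltn_neqAle smin // eq_sym andbT.
have cA' : (#|A :\ s| < k)%N by rewrite (cardsD1 s) sA in cA.
have {}IH := IH (A :\ s) _ cA'.
(* [wedge y] is e_s /\ y. The next claim is d(e_s /\ y) = x_s y - e_s /\ dy; no further sign occurs
   because s is least in A. *)
pose wedge y tau := if s \in tau then y (tau :\ s) else 0.
have dwedge y tau : ksupp (A :\ s) y ->
    koszul (wedge y) tau = if s \in tau then - koszul y (tau :\ s) else 'X_s * y tau.
  move=> yA; rewrite /koszul; case: ifP => sT.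
    rewrite -sumrN [RHS](bigD1 s) ?inE ?eqxx //= (yA (s |: _)) ?mulr0 ?oppr0 ?add0r; last first.
      by apply/subsetPn; exists s; rewrite !inE eqxx.
    apply: eq_big => [t|t tN].
      by rewrite !inE negb_and negbK; case: (eqVneq t s) => [->|]; rewrite ?sT ?andbT.
    have ts : t != s by apply: contraNneq tN => ->.
    have e : (t |: tau) :\ s = t |: (tau :\ s).
      by apply/setP => r; rewrite !inE; case: (eqVneq r t) => [->|]; rewrite ?ts.
    rewrite /wedge !inE sT orbT e; have [tA|tA] := boolP (t \in A :\ s); last first.
      by rewrite (yA (t |: _)) ?mulr0 ?oppr0 //; apply/subsetPn; exists t; rewrite // !inE eqxx.
    rewrite (alphaD1 (s := s)) ?inE ?sT ?orbT // slt // e exprS mulN1r.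
    by rewrite !mulNr.
  rewrite (bigD1 s) ?sT //= big1 ?addr0 => [|t /andP[tN ts]]; last first.
    by rewrite /wedge !inE eq_sym (negPf ts) sT mulr0.
  rewrite /wedge setU11 setU1K ?sT //.
  have [tA|tA] := boolP (tau \subset A :\ s); last by rewrite yA ?mulr0.
  rewrite (_ : alpha _ _ = 0%N) ?mul1r //; apply/eqP; rewrite cards_eq0.
  apply/eqP/setP => r; rewrite !inE; case: eqP => [->|_]; rewrite ?ltnn //=.
  apply/andP => -[/(subsetP tA)/slt rs] /(ltn_trans rs); by rewrite ltnn.
pose x2 tau := if s \in tau then 0 else x (s |: tau).
have x2A : ksupp (A :\ s) x2.
  move=> tau tA; rewrite /x2; case: ifP => // sT; apply: xA; apply: contra tA.
  move/subUsetP=> [_ tA]; apply/subsetP => r rT; rewrite !inE (subsetP tA) // andbT.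
  by apply: contraFneq sT => <-.
have dx2 tau : koszul x2 tau = 0.
  have [sT|sT] := boolP (s \in tau).
    by apply: koszul_eq0 => t _; rewrite /x2 !inE sT orbT.
  have [tA|tA] := boolP (tau \subset A :\ s); last by apply: ksupp_koszul tA.
  have xE sigma : x sigma = wedge x2 sigma + (if s \in sigma then 0 else x sigma).
    rewrite /wedge /x2 !inE eqxx /=; case: ifP => sS; last by rewrite add0r.
    by rewrite setD1K // addr0.
  have := dx (s |: tau); rewrite (eq_koszul (y := fun sigma =>
    wedge x2 sigma + (if s \in sigma then 0 else x sigma)) (fun t _ => xE (t |: _))).
  rewrite koszulD dwedge //.
  rewrite setU11 setU1K // (koszul_eq0 (x := fun sigma => if s \in sigma then 0 else x sigma)) => [/eqP|t _].
    by rewrite addr0 oppr_eq0 => /eqP.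
  by rewrite !inE eqxx orbT.
(* The induction hypothesis needs a chain vanishing at the empty set. The equation dx = 0 there puts
   x_s x2(set0) in the ideal of the other variables, hence x2(set0) too. *)
have [c ec] : exists c : 'I_n -> S, x2 set0 = \sum_(j in A :\ s) c j * 'X_j.
  apply/varsetP; apply: (varset_regular (s := s)); first by rewrite !inE eqxx.
  have := dx set0; rewrite /koszul (bigD1 s) ?inE //=.
  rewrite (_ : alpha _ _ = 0%N) ?mul1r; last first.
    by apply/eqP; rewrite cards_eq0; apply/eqP/setP => r; rewrite !inE orbF;
       case: eqP => // ->; rewrite ltnn.
  rewrite /x2 inE => /eqP; rewrite addr_eq0 => /eqP ->.
  rewrite -sumrN; apply: big_ind => [|a b|t /andP[_ ts]];
    [exact: ideal_gen0|exact: ideal_genD|].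
  have [tA|tA] := boolP (t \in A); last first.
    rewrite xA ?mulr0 ?oppr0; first exact: ideal_gen0.
    by apply/subsetPn; exists t; rewrite // !inE eqxx.
  rewrite mulrAC -mulNr; apply: ideal_genM; exists U_(t)%MM => //.
  by exists t; rewrite // !inE ts.
have [y3 [y3A y30 dy3]] : exists y, [/\ ksupp (A :\ s) y, y set0 = 0
    & forall tau, koszul y tau = x2 tau - koszul (kpoint (A :\ s) c) tau].
  apply: (IH (fun tau => x2 tau - koszul (kpoint (A :\ s) c) tau)).
  - by move=> tau tA; rewrite x2A // (ksupp_koszul (@ksupp_kpoint (A :\ s) c)) // subr0.
  - by rewrite /= koszul_kpoint eqxx mul1r ec subrr.
  - by move=> tau; rewrite koszulD dx2 koszulN koszulK oppr0 addr0.
pose y2 tau := y3 tau + kpoint (A :\ s) c tau.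
have y2A : ksupp (A :\ s) y2.
  by move=> tau tA; rewrite /y2 y3A // (ksupp_kpoint c tA) addr0.
have dy2 tau : koszul y2 tau = x2 tau by rewrite koszulD dy3 subrK.
(* Since d y2 = x2, adding d(e_s /\ y2) = x_s y2 - e_s /\ x2 to x removes its e_s part and leaves a
   cycle on A without s. *)
have [y4 [y4A y40 dy4]] : exists y, [/\ ksupp (A :\ s) y, y set0 = 0
    & forall tau, koszul y tau = x tau + koszul (wedge y2) tau].
  apply: (IH (fun tau => x tau + koszul (wedge y2) tau)).
  - move=> tau tA; rewrite /= dwedge // dy2 /x2 !inE eqxx /=.
    case: ifP => sT; first by rewrite setD1K // subrr.
    rewrite y2A // mulr0 addr0 xA //; apply: contra tA => tA.
    apply/subsetP => r rT; rewrite !inE (subsetP tA) // andbT.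
    by apply: contraFneq sT => <-.
  - by rewrite /= dwedge // inE x0 add0r /y2 y30 kpoint0 add0r mulr0.
  - by move=> tau; rewrite koszulD dx koszulK addr0.
exists (fun tau => y4 tau - wedge y2 tau); split=> [tau tA||tau].
- rewrite y4A; last by apply: contra tA => /subset_trans; apply; apply: subD1set.
  rewrite sub0r /wedge; case: ifP => sT; rewrite ?oppr0 // y2A ?oppr0 //.
  by apply: contra tA => tA; rewrite -(setD1K sA) -(setD1K sT) setUS.
- by rewrite y40 /wedge inE subrr.
- by rewrite koszulD dy4 koszulN addrK.
Qed.

End Koszul.
Lemma regular_scaleE (R : pzRingType) (a : R) (b : R^o) : a *: b = a * b.
Proof. by []. Qed.

(** * The Koszul complex on bases indexed by subsets of fixed size *)

Section KoszulBasis.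
Variables (K : fieldType) (n : nat) (A : {set 'I_n}).
Local Notation S := {mpoly K[n]}.
Implicit Types (sigma tau : {set 'I_n}).

(** Reading a chain as a function on all subsets makes [koszul], which ignores the degree,
    applicable. *)
Definition kext i (x : freeS K n (kbasis A i)) sigma : S :=
  if insub sigma is Some b then x b else 0.

Definition kres i (y : {set 'I_n} -> S) : freeS K n (kbasis A i) :=
  [ffun b => y (val b)].

Lemma kext_val i (x : freeS K n (kbasis A i)) b : kext x (val b) = x b.
Proof. by rewrite /kext valK. Qed.

Lemma kext_out i (x : freeS K n (kbasis A i)) sigma :
  ~~ ((sigma \subset A) && (#|sigma| == i)) -> kext x sigma = 0.
Proof. by move=> sN; rewrite /kext insubN. Qed.

Lemma kext_res i y sigma :
  (sigma \subset A) && (#|sigma| == i) -> kext (kres i y) sigma = y sigma.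
Proof. by move=> sP; rewrite /kext insubT ffunE. Qed.

Lemma kdiffE i (x : freeS K n (kbasis A i.+1)) b :
  kdiff x b = koszul (kext x) (val b).
Proof.
rewrite /kdiff /koszul sum_ffunE.
under eq_bigr => c _ do rewrite ffunE sum_ffunE.
transitivity (\sum_(c : kbasis A i.+1) \sum_(s | s \notin val b)
   (val c == s |: val b)%:R * ((-1) ^+ alpha (s |: val b) s * 'X_s * x c : S)).
  apply: eq_bigr => c _; rewrite /= /GRing.scale /= mulr_sumr.
  rewrite [LHS]big_mkcond [RHS]big_mkcond; apply: eq_bigr => s _.
  rewrite !ffunE; case: ifP => sc; case: ifP => sb.
  - have -> : (val b == val c :\ s) = (val c == s |: val b).
      apply/eqP/eqP => [->|->]; by rewrite ?setD1K ?setU1K.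
    rewrite [X in _ * X]regular_scaleE; case: eqP => [->|_]; last by rewrite !mulr0 mul0r.
    by rewrite mul1r mulr1 mulrC.
  - have -> : val b == val c :\ s = false.
      by apply: contraFF sb => /eqP->; rewrite !inE eqxx.
    by rewrite [X in _ * X]regular_scaleE !mulr0.
  - have -> : val c == s |: val b = false.
      by apply: contraFF sc => /eqP->; rewrite !inE eqxx.
    by rewrite mul0r.
  - by [].
rewrite exchange_big; apply: eq_bigr => s sN /=.
have [P|P] := boolP ((s |: val b \subset A) && (#|s |: val b| == i.+1)).
  pose c0 : kbasis A i.+1 := Sub (s |: val b) P.
  rewrite (bigD1 c0) //= eqxx mul1r big1 ?addr0 => [|c cN]; first by rewrite -kext_val.
  have -> : val c == s |: val b = false by apply: contraNF cN => /eqP e; apply/eqP/val_inj.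
  by rewrite mul0r.
rewrite kext_out // mulr0 big1 // => c _; case: eqP => [e|]; last by rewrite mul0r.
by move: P; rewrite -e (valP c).
Qed.

Lemma kext0 i (x : freeS K n (kbasis A i.+1)) : kext x set0 = 0.
Proof. by rewrite kext_out // cards0 andbF. Qed.

Lemma ksupp_kext i (x : freeS K n (kbasis A i)) : ksupp A (kext x).
Proof. by move=> sigma sA; rewrite kext_out // (negPf sA). Qed.

Lemma koszul_kext_out i (x : freeS K n (kbasis A i.+1)) sigma :
  ~~ ((sigma \subset A) && (#|sigma| == i)) -> koszul (kext x) sigma = 0.
Proof.
move=> sN; apply: koszul_eq0 => s sS; apply: kext_out; apply: contra sN.
by rewrite cardsU1 sS add1n eqSS => /andP[/subUsetP[_ ->] ->].
Qed.

Lemma kext_kdiff i (x : freeS K n (kbasis A i.+1)) sigma :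
  kext (kdiff x) sigma = koszul (kext x) sigma.
Proof.
have [P|P] := boolP ((sigma \subset A) && (#|sigma| == i)).
  pose b : kbasis A i := Sub sigma P.
  by rewrite -[sigma]/(val b) kext_val kdiffE.
by rewrite kext_out // koszul_kext_out.
Qed.

Lemma kdiffK i (x : freeS K n (kbasis A i.+2)) : kdiff (kdiff x) = 0.
Proof.
apply/ffunP => b; rewrite kdiffE [RHS]ffunE -[RHS](koszulK (kext x) (val b)).
by apply: eq_koszul => s _; rewrite kext_kdiff.
Qed.

Lemma kdiff_res i y (b : kbasis A i) : ksupp A y ->
  kdiff (kres i.+1 y) b = koszul y (val b).
Proof.
move=> yA; rewrite kdiffE; apply: eq_koszul => s sN.
have /andP[bA /eqP cb] := valP b.
have [P|P] := boolP (s |: val b \subset A); last by rewrite kext_out ?yA ?(negPf P).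
by rewrite kext_res // P cardsU1 sN cb eqxx.
Qed.

Lemma kdiff_exact i (x : freeS K n (kbasis A i.+1)) :
  kdiff x = 0 -> exists y, kdiff y = x.
Proof.
move=> dx; have [|||y [yA _ dy]] := @koszul_exact K n A (kext x).
- exact: ksupp_kext.
- exact: kext0.
- move=> tau; rewrite -kext_kdiff dx /kext; case: insub => // b; exact: ffunE.
by exists (kres _ y); apply/ffunP => b; rewrite kdiff_res // dy kext_val.
Qed.

Lemma kdiff_exact0 (x : freeS K n (kbasis A 0)) :
  (forall b, mon_ideal (varset A) (x b : S)) -> exists y, kdiff y = x.
Proof.
move=> xI.
have b0P : (set0 \subset A) && (#|@set0 'I_n| == 0)%N by rewrite sub0set cards0.
have bE (b : kbasis A 0) : b = Sub set0 b0P.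
  by apply: val_inj; rewrite SubK; apply/eqP; rewrite -cards_eq0; have /andP[] := valP b.
have /varsetP[c ec] := xI (Sub set0 b0P).
exists (kres 1 (kpoint A c)); apply/ffunP => b.
rewrite kdiff_res; last exact: ksupp_kpoint.
by rewrite koszul_kpoint (bE b) SubK eqxx mul1r ec.
Qed.

End KoszulBasis.
(** * Resolutions by regular decomposition functions *)

Section LinearExtension.
Variables (K : fieldType) (n : nat).
Local Notation S := {mpoly K[n]}.

Definition linext (B : finType) (V : lmodType S) (F : B -> V) (x : freeS K n B) : V :=
  \sum_b x b *: F b.

Fact linext_is_linear (B : finType) (V : lmodType S) (F : B -> V) : linear (@linext B V F).
Proof.
move=> c x y; rewrite /linext scaler_sumr -big_split; apply: eq_bigr => b _ /=.
by rewrite !ffunE scalerDl scalerA.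
Qed.

HB.instance Definition _ (B : finType) (V : lmodType S) (F : B -> V) :=
  GRing.isLinear.Build S (freeS K n B) V *:%R (@linext B V F) (@linext_is_linear B V F).

Lemma linext_base B V F b : @linext B V F (fbase K n b) = F b.
Proof.
rewrite /linext (bigD1 b) //= ffunE eqxx scale1r big1 ?addr0 // => c cb.
by rewrite ffunE (negPf cb) scale0r.
Qed.

Lemma linext_sumE (B B' : finType) (F : B -> freeS K n B') x b' :
  linext F x b' = \sum_b x b * F b b' :> S.
Proof. by rewrite /linext sum_ffunE; apply: eq_bigr => b _; rewrite ffunE. Qed.

Lemma linext_id (B : finType) x : linext (@fbase K n B) x = x.
Proof.
apply/ffunP => b; rewrite linext_sumE (bigD1 b) //= ffunE eqxx mulr1.
by rewrite big1 ?addr0 // => c cb; rewrite ffunE eq_sym (negPf cb) mulr0.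
Qed.

Lemma sum_scale_sub (V : lmodType S) (I : finType) (A : {set I}) (e x y : I -> S) (f g : I -> V) :
  \sum_(s in A) (e s * x s) *: f s - \sum_(s in A) (e s * y s) *: g s =
  \sum_(s in A) e s *: (x s *: f s - y s *: g s).
Proof. by rewrite -sumrB; apply: eq_bigr => s _; rewrite scalerBr !scalerA. Qed.

Lemma sum_alpha_sym (V : lmodType S) (sigma : {set 'I_n}) (B : 'I_n -> 'I_n -> V) :
    (forall s t, B s t = B t s) ->
  \sum_(s in sigma) ((-1) ^+ alpha sigma s : S) *:
    \sum_(t in sigma :\ s) ((-1) ^+ alpha (sigma :\ s) t : S) *: B s t = 0.
Proof.
move=> Bsym; under eq_bigr => s _ do rewrite scaler_sumr.
apply: sum_antisym => s t sS tS ts.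
by rewrite !scalerA (Bsym t s) sign_alphaD1 // scaleNr addNr.
Qed.

Lemma linear_scale_sub (V W : lmodType S) (D : {linear V -> W}) (I : finType)
    (A : {set I}) (e x y : I -> S) (f g : I -> V) :
  D (\sum_(s in A) e s *: (x s *: f s - y s *: g s)) =
  \sum_(s in A) e s *: (x s *: D (f s) - y s *: D (g s)).
Proof.
rewrite linear_sum; apply: eq_bigr => s _.
by rewrite linearZZ linearB !linearZZ.
Qed.

Lemma scale_sum_sub (V : lmodType S) (I : finType) (A : {set I}) (e : I -> S)
    (x y : S) (v w : V) (f g : I -> V) :
    v = \sum_(s in A) e s *: f s -> w = \sum_(s in A) e s *: g s ->
  x *: v - y *: w = \sum_(s in A) e s *: (x *: f s - y *: g s).
Proof.
move=> -> ->; rewrite !scaler_sumr -sumrB; apply: eq_bigr => s _.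
by rewrite scalerBr !scalerA ![e s * _]mulrC.
Qed.

(** The left side is the (s,t) term of the square of [del]; the hypotheses are what commutation of g
    provides. *)
Lemma cross_scale_sym (V : lmodType S) (ys yt yst yts xs xt : S) (f1 f2 fs ft f0 : V) :
    ys * yst = yt * yts -> f1 = f2 ->
  ys *: (yst *: f1 - xt *: fs) - xs *: (yt *: ft - xt *: f0) =
  yt *: (yts *: f2 - xs *: ft) - xt *: (ys *: fs - xs *: f0).
Proof.
move=> ey ->; rewrite !scalerBr !scalerA ey [xs * yt]mulrC [xs * xt]mulrC.
rewrite [ys * xt]mulrC !opprB !addrA addrAC [RHS]addrAC; congr (_ + _).
exact: addrAC.
Qed.

Lemma linear_linext (V W : lmodType S) (D : {linear V -> W}) (B : finType)
    (G : B -> V) x :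
  D (linext G x) = linext (fun b => D (G b)) x.
Proof. by rewrite linear_sum; apply: eq_bigr => b _; rewrite linearZZ. Qed.

Lemma linext0 (V : lmodType S) (B : finType) (G : B -> V) x :
  (forall b, G b = 0) -> linext G x = 0.
Proof. by move=> G0; apply: big1 => b _; rewrite G0 scaler0. Qed.

Lemma eq_linext (V : lmodType S) (B : finType) (G H : B -> V) x :
  (forall b, G b = H b) -> linext G x = linext H x.
Proof. by move=> GH; apply: eq_bigr => b _; rewrite GH. Qed.

Lemma linextB (V : lmodType S) (B : finType) (G H : B -> V) x :
  linext (fun b => G b - H b) x = linext G x - linext H x.
Proof. by rewrite -sumrB; apply: eq_bigr => b _; rewrite scalerBr. Qed.

Lemma linear_sum_scale (V W : lmodType S) (D : {linear V -> W}) (I : finType)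
    (A : {set I}) (e : I -> S) (f : I -> V) :
  D (\sum_(s in A) e s *: f s) = \sum_(s in A) e s *: D (f s).
Proof. by rewrite linear_sum; apply: eq_bigr => s _; rewrite linearZZ. Qed.

Lemma scale_sub_eval0 (B : finType) (e x y : S) (f g : freeS K n B) b :
  f b = 0 -> g b = 0 -> (e *: (x *: f - y *: g)) b = 0.
Proof. by move=> f0 g0; rewrite !ffunE f0 g0 !scaler0 subrr scaler0. Qed.

End LinearExtension.

(** * The iterated mapping cone and its exactness *)

Section HerzogTakayama.
Variables (K : fieldType) (n : nat) (ms : seq 'X_{1..n}).
Local Notation S := {mpoly K[n]}.
Local Notation m_ a := (tnth (in_tuple ms) a).
Local Notation F i := (freeS K n (Fbasis K ms i)).
Implicit Types (a b : 'I_(size ms)) (s t : 'I_n) (sigma tau : {set 'I_n}).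

Lemma mem_takeP a (m : 'X_{1..n}) : reflect (exists2 b : 'I_(size ms), (b < a)%N & m = m_ b) (m \in take a ms).
Proof.
apply: (iffP idP) => [|[b ba ->]].
  move=> mP; have mms := mem_take mP.
  have im : (index m ms < size ms)%N by rewrite index_mem.
  exists (Ordinal im); first by rewrite /= -in_take // .
  by rewrite (tnth_nth m) /= nth_index.
rewrite (tnth_nth (m_ a)) /= -(nth_take _ ba); apply: mem_nth.
by rewrite size_takel // ltnW // ltn_ord.
Qed.

Lemma memsP m : reflect (exists a, m = m_ a) (m \in ms).
Proof. exact: (iffP (tnthP (in_tuple ms) m)). Qed.

Lemma lqsetP a s :
  reflect (exists2 b : 'I_(size ms), (b < a)%N & (m_ b <= U_(s) + m_ a)%MM) (s \in lqset K a).
Proof.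
rewrite inE; apply: (iffP (asboolP _)); rewrite /lqcolon /colon -mpolyXD.
  by move=> /mon_idealX[t /mem_takeP[b ba ->]]; exists b.
by move=> [b ba le]; apply/mon_idealX; exists (m_ b) => //; apply/mem_takeP; exists b.
Qed.

(* The index of g(x_s m_a) in the notation of Herzog and Takayama. *)
Definition decomp a s : 'I_(size ms) :=
  [arg min_(b < a | (m_ b <= U_(s) + m_ a)%MM) b].

(** The factor x_s m_a / g(x_s m_a), the coefficient in the comparison map. *)
Definition cofac a s : 'X_{1..n} := (U_(s) + m_ a - m_ (decomp a s))%MM.

Lemma decomp_le a s : (m_ (decomp a s) <= U_(s) + m_ a)%MM.
Proof. by rewrite /decomp; case: arg_minnP => //; rewrite lem_addl. Qed.

Lemma decomp_min a s b : (m_ b <= U_(s) + m_ a)%MM -> (decomp a s <= b)%N.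
Proof. by rewrite /decomp; case: arg_minnP => [|c _]; [rewrite lem_addl|apply]. Qed.

Lemma decompP a s c : (m_ c <= U_(s) + m_ a)%MM ->
  (forall b, (m_ b <= U_(s) + m_ a)%MM -> (c <= b)%N) -> decomp a s = c.
Proof.
move=> cP cmin; apply/val_inj/eqP; rewrite eqn_leq decomp_min //.
by rewrite cmin ?decomp_le.
Qed.

Lemma cofacK a s : (cofac a s + m_ (decomp a s) = U_(s) + m_ a)%MM.
Proof. exact: submK (decomp_le a s). Qed.

Lemma decomp_lt a s : s \in lqset K a -> (decomp a s < a)%N.
Proof. by move=> /lqsetP[b ba /decomp_min le]; apply: leq_ltn_trans ba. Qed.

Lemma decomp_out a s : s \notin lqset K a -> decomp a s = a.
Proof.
move=> sN; apply: decompP => [|b bP]; first exact: lem_addl.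
by rewrite leqNgt; apply: contra sN => ba; apply/lqsetP; exists b.
Qed.

Hypothesis ms_anti : forall a b, (m_ a <= m_ b)%MM -> a = b.
Hypothesis ms_pos : forall a, m_ a != 0%MM.
(** Linear quotients in terms of exponents: m_b / gcd(m_a, m_b) is divisible by a variable of
    set(m_a). *)
Hypothesis ms_lq : forall a b, (b < a)%N -> exists2 s, s \in lqset K a & (m_ a s < m_ b s)%N.
Hypothesis ms_reg : forall a s, s \in lqset K a ->
  lqset K (decomp a s) \subset lqset K a.

Lemma lqset_decomp a s : lqset K (decomp a s) \subset lqset K a.
Proof.
by have [/ms_reg //|/decomp_out->] := boolP (s \in lqset K a); apply: subxx.
Qed.

Lemma cofac_neq0 a s : cofac a s != 0%MM.
Proof.
apply/eqP => c0; have := cofacK a s; rewrite c0 add0m => e.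
have ag : a = decomp a s by apply: ms_anti; rewrite e lem_addl.
have := congr1 (@mdeg n) e; rewrite -ag mdegD mdeg1 => /eqP.
by rewrite -{1}[mdeg _]add0n eqn_add2r.
Qed.

Lemma cofac_out a s : s \notin lqset K a -> cofac a s = U_(s)%MM.
Proof. by move=> sN; rewrite /cofac decomp_out // addmK. Qed.

(** Otherwise a generator preceding g(x_s m_a) and dividing x_t g(x_s m_a) would divide x_s m_a,
    against the choice of g. *)
Lemma cofac_disjoint a s t : t \in lqset K (decomp a s) -> cofac a s t = 0%N.
Proof.
move=> /lqsetP[b bg le_b]; apply/eqP; rewrite -[_ == _]negbK -lep1mP.
apply/negP => tc; have := bg; rewrite ltnNge decomp_min //.
apply: lepm_trans le_b _; rewrite -[(U_(s) + _)%MM]cofacK; apply/mnm_lepP => r.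
by rewrite !mnmDE leq_add2r (mnm_lepP tc).
Qed.

(* Both sides are the first generator dividing x_s x_t m_a: the complementary *)
(* factor avoids lqset, and the colon ideals are generated by variables.      *)
Lemma decompC a s t : decomp (decomp a s) t = decomp (decomp a t) s.
Proof.
pose M := (U_(s) + U_(t) + m_ a)%MM.
have first s' t' : (U_(s') + U_(t') + m_ a)%MM = M ->
    (m_ (decomp (decomp a s') t') <= M)%MM /\
    forall b, (m_ b <= M)%MM -> (decomp (decomp a s') t' <= b)%N.
  move=> eM; set c := decomp _ _.
  have cM : (M = cofac a s' + cofac (decomp a s') t' + m_ c)%MM.
    rewrite -eM; apply/mnmP => i; move/mnmP/(_ i): (cofacK a s').
    by move/mnmP/(_ i): (cofacK (decomp a s') t'); rewrite !mnmDE /c; lia.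
  split; first by rewrite cM lem_addl.
  move=> b bM; rewrite leqNgt; apply/negP => /ms_lq[r rc].
  rewrite ltnNge => /negP; apply; have := mnm_lepP bM r.
  rewrite cM !mnmDE (cofac_disjoint rc) cofac_disjoint //.
  by move: rc; apply/subsetP; apply: lqset_decomp.
have [le1 min1] := first s t erefl.
have [le2 min2] := first t s (congr1 (fun m => m + m_ a)%MM (addmC _ _)).
by apply/val_inj/eqP; rewrite eqn_leq min1 ?min2.
Qed.

Lemma cofacC a s t :
  (cofac a s + cofac (decomp a s) t = cofac a t + cofac (decomp a t) s)%MM.
Proof.
have := cofacK (decomp a t) s; rewrite -decompC.
move: (cofacK a s) (cofacK a t) (cofacK (decomp a s) t).
move: (m_ _) (m_ _) (m_ _) (m_ _) (cofac _ _) (cofac _ _) (cofac _ _) (cofac _ _).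
move=> m1 m2 m3 m4 c1 c2 c3 c4 e1 e2 e3 e4; apply/mnmP => i.
by move/mnmP/(_ i): e1; move/mnmP/(_ i): e2; move/mnmP/(_ i): e3;
   move/mnmP/(_ i): e4; rewrite !mnmDE; lia.
Qed.

Lemma symbol_sub (i : nat) (b : symbol K ms i) :
  (val b).2 \subset lqset K (val b).1 /\ #|(val b).2| = i.
Proof. by have /andP[bA /eqP bi] := valP b. Qed.

(** Indexed by the position of the generator, where [fsymb] uses the monomial; [fsymb_fs] identifies
    the two. *)
Definition fs i a sigma : F i.+1 := [ffun b : symbol K ms i => (val b == (a, sigma))%:R].

Lemma fs_base i (b : symbol K ms i) : fs i (val b).1 (val b).2 = fbase K n b.
Proof. apply/ffunP => c; rewrite [LHS]ffunE [RHS]ffunE -surjective_pairing.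
by rewrite (inj_eq val_inj). Qed.

Lemma fs_out i a sigma : ~~ (sigma \subset lqset K a) -> fs i a sigma = 0.
Proof.
move=> sN; apply/ffunP => b; rewrite !ffunE; case: eqP => // e.
by have [] := symbol_sub b; rewrite e (negPf sN).
Qed.

Lemma m_inj a b : m_ a = m_ b -> a = b.
Proof. by move=> e; apply: ms_anti; rewrite e lepm_refl. Qed.

Lemma fsymb_fs i a sigma : fsymb K ms i sigma (m_ a) = fs i a sigma.
Proof.
apply/ffunP => b; rewrite !ffunE /sgen; case: (val b) => c tau /=.
by rewrite xpair_eqE andbC (inj_eq m_inj).
Qed.

Lemma fs_neq0 i a sigma (b : Fbasis K ms i.+1) :
  fs i a sigma b != 0 -> val b = (a, sigma).
Proof. by rewrite ffunE; case: (val b =P _) => // _; rewrite eqxx. Qed.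

(** The comparison map on a Koszul basis element. With [kosz_symb], the Koszul differential in the
    same coordinates, the mapping cone differential is the difference of the two. *)
Definition psi_symb i a sigma : F i :=
  if i is j.+1 then
    \sum_(s in sigma) ((-1) ^+ alpha sigma s * 'X_[cofac a s] : S)
      *: fs j (decomp a s) (sigma :\ s)
  else [ffun=> 'X_[m_ a]].

Definition kosz_symb i a sigma : F i :=
  if i is j.+1 then
    \sum_(s in sigma) ((-1) ^+ alpha sigma s * 'X_s : S) *: fs j a (sigma :\ s)
  else 0.

Definition del i : {linear F i.+1 -> F i} :=
  linext (fun b : symbol K ms i =>
    psi_symb i (val b).1 (val b).2 - kosz_symb i (val b).1 (val b).2).

Definition psi a i : {linear freeS K n (kbasis (lqset K a) i) -> F i} :=
  linext (fun b : kbasis (lqset K a) i => psi_symb i a (val b)).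

Definition kfs a i : {linear freeS K n (kbasis (lqset K a) i) -> F i.+1} :=
  linext (fun b : kbasis (lqset K a) i => fs i a (val b)).

Lemma psi_kosz_symbS i a sigma :
  psi_symb i.+1 a sigma - kosz_symb i.+1 a sigma =
  \sum_(s in sigma) ((-1) ^+ alpha sigma s : S) *:
    ('X_[cofac a s] *: fs i (decomp a s) (sigma :\ s) - 'X_s *: fs i a (sigma :\ s)).
Proof.
exact: sum_scale_sub.
Qed.

(* Symbols f(sigma; m_a) with sigma not in lqset a are 0, and the formula     *)
(* for the differential returns 0 on them.                                    *)
Lemma del_fs i a sigma : #|sigma| = i ->
  del i (fs i a sigma) = psi_symb i a sigma - kosz_symb i a sigma.
Proof.
move=> ci; have [sA|sN] := boolP (sigma \subset lqset K a).
  have P : (sigma \subset lqset K a) && (#|sigma| == i) by rewrite sA ci eqxx.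
  have -> : fs i a sigma = fbase K n (Sub (a, sigma) P : symbol K ms i) by rewrite -fs_base.
  exact: linext_base.
rewrite (fs_out i sN) linear0; case: i ci => [/cards0_eq e|i ci].
  by rewrite e sub0set in sN.
rewrite psi_kosz_symbS big1 // => s sS.
have [sA|sA] := boolP (s \in lqset K a); last first.
  by rewrite cofac_out // decomp_out // subrr scaler0.
have [r rS rN] := subsetPn sN.
have rN' : ~~ (sigma :\ s \subset lqset K a).
  by apply/subsetPn; exists r; rewrite // !inE rS andbT; apply: contraNneq rN => ->.
rewrite !fs_out ?scaler0 ?subrr ?scaler0 //.
by apply: contra rN' => /subset_trans; apply; apply: lqset_decomp.
Qed.

(** By [decompC] and [cofacC] the (s,t) terms are symmetric, and the signs cancel them. In lowest
    degree the identity is [cofacK]. *)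
Lemma del_symb i a sigma : #|sigma| = i.+1 ->
  del i (psi_symb i.+1 a sigma - kosz_symb i.+1 a sigma) = 0.
Proof.
move=> ci; rewrite psi_kosz_symbS linear_scale_sub.
have cD s : s \in sigma -> #|sigma :\ s| = i.
  by move=> sS; move: ci; rewrite (cardsD1 s) sS => -[].
under eq_bigr => s sS do rewrite !del_fs ?cD //.
case: i ci cD => [|i] ci cD.
  apply: big1 => s _ /=; rewrite !subr0.
  rewrite (_ : _ - _ = 0) ?scaler0 //.
  by apply/ffunP => b; rewrite !ffunE /GRing.scale /= -!mpolyXD cofacK subrr.
rewrite -[RHS](sum_alpha_sym sigma (B := fun s t =>
  'X_[cofac a s] *: ('X_[cofac (decomp a s) t] *:
      fs i (decomp (decomp a s) t) (sigma :\ s :\ t)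
    - 'X_t *: fs i (decomp a s) (sigma :\ s :\ t))
  - 'X_s *: ('X_[cofac a t] *: fs i (decomp a t) (sigma :\ s :\ t)
    - 'X_t *: fs i a (sigma :\ s :\ t)))).
  apply: eq_bigr => s _; congr (_ *: _).
  by apply: scale_sum_sub; apply: psi_kosz_symbS.
move=> s t; lazy beta; rewrite (decompC a t s).
have -> : sigma :\ t :\ s = sigma :\ s :\ t by rewrite !setDDl setUC.
apply: cross_scale_sym; last by [].
by rewrite -!mpolyXD cofacC.
Qed.

Lemma del_del i x : del i (del i.+1 x) = 0.
Proof.
rewrite (linear_linext (del i)); apply: linext0 => b.
by have [_ cb] := symbol_sub b; apply: del_symb.
Qed.

Lemma kincl_kfs a i (x : freeS K n (kbasis (lqset K a) i)) : kincl x = kfs a i x.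
Proof. by apply: eq_bigr => b _; rewrite fsymb_fs. Qed.

Lemma linext_ksym (V : lmodType S) (A : {set 'I_n}) i (G : kbasis A i -> V) sigma
    (P : (sigma \subset A) && (#|sigma| == i)) :
  linext G (ksym K A i sigma) = G (Sub sigma P).
Proof.
exact: (linext_base G (Sub sigma P)).
Qed.

Lemma kfs_kdiff a i x :
  kfs a i (kdiff x) =
  linext (fun b : kbasis (lqset K a) i.+1 => kosz_symb i.+1 a (val b)) x.
Proof.
rewrite [kdiff x](_ : _ = linext (fun b : kbasis (lqset K a) i.+1 =>
  \sum_(s in val b) ((-1) ^+ alpha (val b) s * 'X_s : S)
    *: ksym K (lqset K a) i (val b :\ s)) x) //.
rewrite (linear_linext (kfs a i)); apply: eq_linext => b.
rewrite linear_sum_scale; apply: eq_bigr => s sb; congr (_ *: _).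
have /andP[bA /eqP cb] := valP b.
have P : (val b :\ s \subset lqset K a) && (#|val b :\ s| == i).
  by rewrite (subset_trans (subD1set _ _) bA) /=; move: cb; rewrite (cardsD1 s) sb add1n => -[->].
by rewrite /kfs /= (linext_ksym _ P).
Qed.

Lemma del_kfs0 a x : del 0 (kfs a 0 x) = psi a 0 x.
Proof.
rewrite (linear_linext (del 0)); apply: eq_linext => b.
have /andP[_ /eqP cb] := valP b; rewrite del_fs //; exact: subr0.
Qed.

Lemma del_kfsS a i x : del i.+1 (kfs a i.+1 x) = psi a i.+1 x - kfs a i (kdiff x).
Proof.
rewrite (linear_linext (del i.+1)) kfs_kdiff -linextB; apply: eq_linext => b.
by have /andP[_ /eqP cb] := valP b; apply: del_fs.
Qed.

(** Solving the mapping cone formula for [psi] turns the vanishing of the square of [del] into the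
    chain map property. *)
Lemma psi_kdiff a i x : del i (psi a i.+1 x) = psi a i (kdiff x).
Proof.
have -> : psi a i.+1 x = del i.+1 (kfs a i.+1 x) + kfs a i (kdiff x).
  by rewrite del_kfsS subrK.
rewrite linearD del_del add0r; case: i x => [|i] x; first exact: del_kfs0.
by rewrite del_kfsS kdiffK linear0 subr0.
Qed.

Lemma psi_stage a i x (b : Fbasis K ms i) : psi a i x b != 0 -> (stage b <= a)%N.
Proof.
case: i x b => [|i] x b //; apply: contraNleq => ba.
rewrite linext_sumE big1 // => c _; have /andP[cA _] := valP c.
rewrite /psi_symb sum_ffunE big1 ?mulr0 // => s sc.
rewrite ffunE (_ : fs _ _ _ _ = 0) ?scaler0 //.
apply/eqP/negPn/negP => /fs_neq0 e; move: ba; rewrite /stage e /=.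
by rewrite ltnS leqNgt decomp_lt // (subsetP cA).
Qed.

Lemma del_mapping_cone : iterated_mapping_cone del.
Proof.
move=> a; exists (psi a); split.
  split; [exact: psi_stage| |exact: psi_kdiff].
  have P : (set0 \subset lqset K a) && (#|@set0 'I_n| == 0)%N by rewrite sub0set cards0.
  by rewrite /psi /= (linext_ksym _ P).
split=> [x|i x]; rewrite !kincl_kfs; first exact: del_kfs0.
exact: del_kfsS.
Qed.

(** g never moves forward in the list, so the symbols of the first c generators span a
    subcomplex. *)
Lemma del_stage i (x : F i.+1) c :
    (forall b : Fbasis K ms i.+1, x b != 0 -> (stage b <= c)%N) ->
  forall b : Fbasis K ms i, del i x b != 0 -> (stage b <= c)%N.
Proof.
case: i x => [|i] x xc b //; apply: contraNleq => bc.
rewrite linext_sumE big1 // => b' _.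
have [->|/xc b'c] := eqVneq (x b') 0; first by rewrite mul0r.
have b'b : ((val b').1 < (val b).1)%N by apply: leq_trans b'c bc.
have [b'A _] := symbol_sub b'.
rewrite psi_kosz_symbS sum_ffunE big1 ?mulr0 // => s sb'.
have fs0 (a : 'I_(size ms)) tau : (a <= (val b').1)%N -> fs i a tau b = 0.
  move=> cb'; apply/eqP/negPn/negP => /fs_neq0 e.
  by move: b'b; rewrite e /= ltnNge cb'.
have db' : (decomp (val b').1 s <= (val b').1)%N.
  by rewrite ltnW // decomp_lt // (subsetP b'A).
by apply: scale_sub_eval0; apply: fs0.
Qed.

(** The part of x on the symbols of m_a, as a Koszul chain on set(m_a). *)
Definition top a i (x : F i.+1) : freeS K n (kbasis (lqset K a) i) :=
  [ffun b => if insub (a, val b) is Some b' then x b' else 0].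

Lemma kfsE a i x (b : symbol K ms i) :
  kfs a i x b = if (val b).1 == a then kext x (val b).2 else 0.
Proof.
rewrite linext_sumE.
under eq_bigr => c _ do rewrite ffunE.
case: eqP => [e|ne]; last first.
  rewrite big1 // => c _; rewrite (_ : (val b == _) = false) ?mulr0 //.
  by apply/eqP => e; apply: ne; rewrite e.
have P : ((val b).2 \subset lqset K a) && (#|(val b).2| == i).
  by rewrite -e; have [-> ->] := symbol_sub b; rewrite eqxx.
pose c0 : kbasis (lqset K a) i := Sub (val b).2 P.
rewrite (bigD1 c0) //= {1}[val b]surjective_pairing e eqxx mulr1 big1 ?addr0 => [|c cN].
  by rewrite -(kext_val x c0).
rewrite (_ : (val b == _) = false) ?mulr0 //; apply: contraNF cN => /eqP eb.
by apply/eqP/val_inj; rewrite /= eb.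
Qed.

Lemma kext_top a i (x : F i.+1) (b : symbol K ms i) :
  (val b).1 = a -> kext (top a x) (val b).2 = x b.
Proof.
move=> e; have [bA cb] := symbol_sub b; rewrite e in bA.
have P : ((val b).2 \subset lqset K a) && (#|(val b).2| == i) by rewrite bA cb eqxx.
rewrite -[(val b).2]/(val (Sub (val b).2 P : kbasis (lqset K a) i)) kext_val ffunE.
by rewrite /= -e -surjective_pairing valK.
Qed.

Lemma sub_top_stage a i (x : F i.+1) :
    (forall b : Fbasis K ms i.+1, x b != 0 -> (stage b <= a.+1)%N) ->
  forall b : Fbasis K ms i.+1, (x - kfs a i (top a x)) b != 0 -> (stage b <= a)%N.
Proof.
move=> xa b; rewrite 2!ffunE kfsE; have [e|ne] := eqVneq (val b).1 a.
  by rewrite kext_top // subrr eqxx.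
rewrite subr0 => /xa; rewrite leq_eqVlt => /orP[/eqP[e]|//].
by case/eqP: ne; apply: val_inj.
Qed.

(** Induction on the number c of generators involved. If the top part is the Koszul boundary of y,
    adding [del] of [kfs y] replaces it by [psi y], which involves earlier generators only. *)
Lemma del_exact i (x : F i.+1) : del i x = 0 -> exists y, x = del i.+1 y.
Proof.
suff H c : forall x : F i.+1,
    (forall b : Fbasis K ms i.+1, x b != 0 -> (stage b <= c)%N) ->
    del i x = 0 -> exists y, x = del i.+1 y.
  by apply: (H (size ms)) => b _; apply: ltn_ord.
elim: c => [|c IH] {}x xc dx.
  exists 0; rewrite linear0; apply/ffunP => b; rewrite [RHS]ffunE.
  by apply/eqP/negPn/negP => /xc.
have [cms|cms] := leqP (size ms) c.
  by apply: IH => // b _; apply: leq_trans cms; apply: ltn_ord.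
pose a := Ordinal cms; pose z := x - kfs a i (top a x).
have za (b : Fbasis K ms i.+1) : z b != 0 -> (stage b <= a)%N by apply: sub_top_stage.
have [y ey] : exists y, kdiff y = top a x.
  have xE : x = kfs a i (top a x) + z by rewrite addrC subrK.
  case: i x xc dx IH z za xE => [|i] x xc dx IH z za xE.
    (* Here the top part is one coefficient p with p m_a in the ideal of the earlier generators;
       [ms_lq] finds a variable of set(m_a) in each term of p. *)
    apply: kdiff_exact0 => b; apply/mon_idealP => m mP.
    have dz : top a x b * 'X_[m_ a] = - (del 0 z tt : S).
      move: dx; rewrite xE linearD del_kfs0 => /ffunP/(_ tt)/eqP.
      rewrite -xE 2!ffunE addr_eq0 => /eqP <-; rewrite linext_sumE (bigD1 b) //=.
      rewrite big1 ?addr0 => [|b' /eqP[]]; first by rewrite [X in _ = _ * X]ffunE.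
      apply: val_inj.
      have /andP[_] := valP b; have /andP[_] := valP b'.
      by rewrite !cards_eq0 => /eqP-> /eqP->.
    have : (m_ a + m)%MM \in msupp (top a x b * 'X_[m_ a]).
      by rewrite mcoeff_msupp mcoeffMX -mcoeff_msupp.
    rewrite dz (perm_mem (msuppN _)) linext_sumE => /msupp_sum_le/flatten_mapP[b' _].
    have [->|/za ca] := eqVneq (z b') 0; first by rewrite mul0r msupp0.
    rewrite subr0 ffunE => /msuppM_le/allpairsP[[m1 m2] /= [_ /mem_msuppXP <- em]].
    have [s sA ms_c] := ms_lq ca.
    exists U_(s)%MM; first by exists s.
    have e : (m_ a s + m s = m1 s + m_ (val b').1 s)%N.
      by move/mnmP/(_ s): em; rewrite !mnmDE.
    by rewrite lep1mP -lt0n -(ltn_add2l (m_ a s)) addn0 e ltn_addl.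
  (* At the symbols of m_a, [psi] and [del z] have no coordinate, so the equation reduces to the
     Koszul cycle condition. *)
  apply: kdiff_exact; apply/ffunP => b; rewrite [RHS]ffunE.
  have /andP[bA cb] := valP b.
  have P : (val b \subset lqset K a) && (#|val b| == i) by rewrite bA.
  pose b0 : symbol K ms i := Sub (a, val b) P.
  have p0 : psi a i.+1 (top a x) b0 = 0.
    by apply/eqP/negPn/negP => /psi_stage; rewrite /= ltnn.
  have z0 : del i.+1 z b0 = 0.
    by apply/eqP/negPn/negP => /(del_stage za); rewrite /= ltnn.
  move: dx; rewrite xE linearD del_kfsS => /ffunP/(_ b0); rewrite -xE.
  rewrite [LHS]ffunE z0 addr0 [LHS]ffunE p0 add0r [LHS]ffunE [RHS]ffunE kfsE eqxx.
  by rewrite kext_val => /eqP; rewrite oppr_eq0 => /eqP.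
have [||y' ey'] := IH (z + psi a i.+1 y).
- move=> b; rewrite ffunE; have [->|/za//] := eqVneq (z b) 0.
  by rewrite add0r => /psi_stage.
- have -> : z + psi a i.+1 y = x + del i.+1 (kfs a i.+1 y).
    by rewrite del_kfsS ey /z addrA addrAC.
  by rewrite linearD dx del_del addr0.
exists (y' - kfs a i.+1 y); rewrite linearB -ey' del_kfsS ey.
by rewrite opprB addrACA subrK subrr addr0.
Qed.

Lemma msupp_sign k (p : S) m : m \in msupp ((-1) ^+ k * p) -> m \in msupp p.
Proof.
rewrite -signr_odd; case: (odd k); rewrite ?mul1r // expr1 mulN1r.
by rewrite (perm_mem (msuppN _)).
Qed.

Lemma del_base i (b : Fbasis K ms i.+1) : del i (fbase K n b) =
  psi_symb i (val b).1 (val b).2 - kosz_symb i (val b).1 (val b).2.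
Proof. exact: linext_base. Qed.

Lemma psi_kosz_symb0 a sigma : psi_symb 0 a sigma - kosz_symb 0 a sigma = [ffun=> 'X_[m_ a]].
Proof. exact: subr0. Qed.

(** That m is not 1 gives minimality: a trivial cofactor would make x_s m_a a generator, properly
    divisible by m_a. *)
Lemma del_base_supp i (b : Fbasis K ms i.+1) (b' : Fbasis K ms i) m :
    m \in msupp (del i (fbase K n b) b' : S) ->
  m != 0%MM /\ Fdeg b = (mdeg m + Fdeg b')%N.
Proof.
have [bA cb] := symbol_sub b; rewrite del_base.
case: i b b' bA cb => [|i] b b' bA cb.
  rewrite psi_kosz_symb0 ffunE => /mem_msuppXP <-.
  by rewrite ms_pos /Fdeg cb /sgen addn0 add0n.
rewrite psi_kosz_symbS sum_ffunE => /msupp_sum_le/flatten_mapP[s].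
rewrite mem_filter => /andP[sb _]; rewrite ffunE => /msupp_sign.
have cD : #|(val b).2| = #|(val b).2 :\ s|.+1 by rewrite (cardsD1 s) sb.
rewrite ffunE => /msuppD_le; rewrite mem_cat => /orP[].
  rewrite ffunE; have [->|] := eqVneq (fs i (decomp (val b).1 s) ((val b).2 :\ s) b') 0.
    by rewrite scaler0 msupp0.
  move=> /(@fs_neq0 i) eb'.
  rewrite ffunE eb' eqxx [X in msupp X]mulr1 => /mem_msuppXP <-.
  rewrite cofac_neq0; split=> //; rewrite /Fdeg /sgen eb' /= cD.
  have := congr1 (@mdeg n) (cofacK (val b).1 s); rewrite !mdegD mdeg1.
  by move: (mdeg _) (mdeg _) (mdeg _) #|_|; clear; lia.
rewrite ffunE (perm_mem (msuppN _)) ffunE.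
have [->|] := eqVneq (fs i (val b).1 ((val b).2 :\ s) b') 0.
  by rewrite scaler0 msupp0.
move=> /(@fs_neq0 i) eb'.
rewrite ffunE eb' eqxx [X in msupp X]mulr1 => /mem_msuppXP <-.
by rewrite mnm1_eq0 mdeg1 /Fdeg /sgen eb' /= cD; split.
Qed.

Lemma del_resolution (J : S -> Prop) :
    (forall p, J p <-> mon_ideal (fun m => m \in ms) p) ->
  minimal_graded_free_resolution (@Fdeg K n ms) del J.
Proof.
move=> JE; split.
- by rewrite card_unit.
- move=> p; apply: (iff_trans (JE p)); split=> [pI|[x ex]].
    pattern p; apply: (ideal_gen_lin _ _ _ pI) => {p pI} [|p q [x ex] [y ey]|c p].
    + by exists 0; rewrite linear0; apply/ffunP => b; rewrite !ffunE.
    + by exists (x + y); rewrite linearD ex ey; apply/ffunP => b; rewrite !ffunE.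
    + move=> [_ /memsP[a ->] ->]; exists (c *: fs 0 a set0).
      rewrite linearZZ del_fs ?cards0 // psi_kosz_symb0.
      by apply/ffunP => b; rewrite !ffunE.
  have -> : p = del 0 x tt by rewrite ex ffunE.
  rewrite linext_sumE; apply: big_ind => [|q r|b _]; [exact: ideal_gen0|exact: ideal_genD|].
  rewrite psi_kosz_symb0 ffunE; apply: ideal_genM; exists (sgen b) => //.
  by apply/memsP; exists (val b).1.
- move=> i x; split=> [/del_exact //|[y ->]]; exact: del_del.
- by move=> i b b' m /del_base_supp[].
- move=> i x b'; rewrite -[x]linext_id (linear_linext (del i)) linext_sumE.
  apply: memN_msupp_eq0; apply/negP => /msupp_sum_le/flatten_mapP[b _].
  move=> /msuppM_le/allpairsP[[m1 m2] /= [_ /del_base_supp[/negPf m20 _]]].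
  by move=> /esym/eqP; rewrite mnmD_eq0 m20 andbF.
Qed.

End HerzogTakayama.

(** * Monomials stable under x_t |-> x_s *)

Section Orders.
Variable n : nat.
Implicit Types (m w : 'X_{1..n}) (s t : 'I_n).

Lemma lexltP m1 m2 :
  reflect (exists s : 'I_n, (forall i : 'I_n, (i < s)%N -> m1 i = m2 i) /\ (m1 s < m2 s)%N)
          (lexlt m1 m2).
Proof.
apply: (iffP existsP) => -[s].
  by move=> /andP[/forallP eq_lt lt_s]; exists s; split=> // i /(implyP (eq_lt i))/eqP.
move=> [eq_lt lt_s]; exists s; rewrite lt_s andbT; apply/forallP => i.
by apply/implyP => /eq_lt ->.
Qed.

Lemma revlexltP m1 m2 :
  reflect (exists s : 'I_n, (forall i : 'I_n, (s < i)%N -> m1 i = m2 i) /\ (m2 s < m1 s)%N)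
          (revlexlt m1 m2).
Proof.
apply: (iffP existsP) => -[s].
  by move=> /andP[/forallP eq_lt lt_s]; exists s; split=> // i /(implyP (eq_lt i))/eqP.
move=> [eq_lt lt_s]; exists s; rewrite lt_s andbT; apply/forallP => i.
by apply/implyP => /eq_lt ->.
Qed.

Lemma lexltxx m : lexlt m m = false.
Proof. by apply/lexltP => -[s [_]]; rewrite ltnn. Qed.

Lemma revlexltxx m : revlexlt m m = false.
Proof. by apply/revlexltP => -[s [_]]; rewrite ltnn. Qed.

Lemma lexlt_trans : transitive (@lexlt n).
Proof.
move=> m2 m1 m3 /lexltP[s [es ls]] /lexltP[t [et lt]]; apply/lexltP.
have [st|ts|/val_inj e] := ltngtP s t.
- exists s; rewrite -et //; split=> // i lti.
  by rewrite es // et // (ltn_trans lti).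
- exists t; rewrite es //; split=> // i lti.
  by rewrite es ?et // (ltn_trans lti).
- by subst t; exists s; split=> [i lti|]; [rewrite es ?et|apply: ltn_trans lt].
Qed.

Lemma revlexlt_trans : transitive (@revlexlt n).
Proof.
move=> m2 m1 m3 /revlexltP[s [es ls]] /revlexltP[t [et lt]]; apply/revlexltP.
have [st|ts|/val_inj e] := ltngtP s t.
- exists t; rewrite es //; split=> // i lti.
  by rewrite es ?et // (ltn_trans st).
- exists s; rewrite -et //; split=> // i lti.
  by rewrite es ?et // (ltn_trans ts).
- by subst t; exists s; split=> [i lti|]; [rewrite es ?et|apply: ltn_trans ls].
Qed.

Lemma lexlt_total m1 m2 : m1 != m2 -> lexlt m1 m2 || lexlt m2 m1.
Proof.
move=> ne; have [i0 ne0] : exists i, m1 i != m2 i.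
  apply/existsP; apply: contraNT ne; rewrite negb_exists => /forallP e.
  by apply/eqP/mnmP => i; apply/eqP; rewrite -[_ == _]negbK.
have [s nes smin] := arg_minnP (@nat_of_ord n) (ne0 : (fun i => m1 i != m2 i) i0).
have es (i : 'I_n) : (i < s)%N -> m1 i = m2 i.
  by move=> lti; apply/eqP; apply: contraTT lti => /smin; rewrite -leqNgt.
have := nes; rewrite neq_ltn => /orP[lt|lt]; apply/orP; [left|right]; apply/lexltP.
  by exists s.
by exists s; split=> // i /es.
Qed.

Lemma lexleNgt m1 m2 : lexle m1 m2 = ~~ lexlt m2 m1.
Proof.
rewrite /lexle; have [->|/lexlt_total ne] := eqVneq m1 m2; first by rewrite lexltxx.
rewrite /=; apply/idP/idP => [lt|/negPf lt]; last by rewrite lt orbF in ne.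
by apply/negP => /(lexlt_trans lt); rewrite lexltxx.
Qed.

Lemma lexle_refl m : lexle m m. Proof. by rewrite /lexle eqxx. Qed.

Lemma lexle_trans : transitive (@lexle n).
Proof.
move=> m2 m1 m3 /orP[/eqP->//|lt] /orP[/eqP<-|lt']; first by rewrite /lexle lt orbT.
by rewrite /lexle (lexlt_trans lt lt') orbT.
Qed.

Lemma lexltW m1 m2 : lexlt m1 m2 -> lexle m1 m2.
Proof. by rewrite /lexle orbC => ->. Qed.

Lemma lexlt_le_trans m1 m2 m3 : lexlt m1 m2 -> lexle m2 m3 -> lexlt m1 m3.
Proof. by move=> lt /orP[/eqP<-//|]; apply: lexlt_trans lt. Qed.

(** The additive form avoids truncated subtraction and covers s = t. *)
Lemma moveE w s t (i : 'I_n) : w t != 0%N ->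
  ((U_(s) + w - U_(t))%MM i + (t == i) = (s == i) + w i)%N.
Proof.
move=> wt; rewrite mnmBE mnmDE !mnm1E; have [e|_] := eqVneq t i; last by rewrite subn0 addn0.
by rewrite subnK // addn_gt0 -e orbC lt0n wt.
Qed.

Lemma lexlt_move w s t : w t != 0%N -> (t < s)%N -> lexlt (U_(s) + w - U_(t))%MM w.
Proof.
move=> wt ts; apply/lexltP; exists t; split=> [i it|]; last first.
  by have := moveE s t wt; rewrite eqxx -(val_eqE s) /= gtn_eqF // addn1 add0n => ->.
have := moveE s i wt; rewrite -(val_eqE s) -(val_eqE t) /= !gtn_eqF ?addn0 ?add0n //.
exact: ltn_trans ts.
Qed.

Lemma revlexlt_move w s t : w t != 0%N -> (t < s)%N -> revlexlt (U_(s) + w - U_(t))%MM w.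
Proof.
move=> wt ts; apply/revlexltP; exists s; split=> [i si|]; last first.
  by have := moveE s s wt; rewrite eqxx -(val_eqE t) /= ltn_eqF // addn0 add1n => ->.
have := moveE s i wt; rewrite -(val_eqE s) -(val_eqE t) /= !ltn_eqF ?addn0 ?add0n //.
exact: ltn_trans si.
Qed.

(** This is why g removes the variable of least possible index. *)
Lemma revlexlt_move2 m t1 t2 : m t2 != 0%N -> (t1 < t2)%N ->
  revlexlt (m - U_(t1))%MM (m - U_(t2))%MM.
Proof.
move=> mt lt; apply/revlexltP; exists t2; split=> [i ti|].
  rewrite !mnmBE !mnm1E -!val_eqE /= !ltn_eqF //; exact: ltn_trans ti.
by rewrite !mnmBE !mnm1E eqxx -val_eqE /= ltn_eqF // subn0 ltn_subrL /= lt0n.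
Qed.

Lemma dvd_degS m w s : mdeg m = mdeg w -> (m <= U_(s) + w)%MM ->
  exists2 t : 'I_n, (U_(s) + w)%MM t != 0%N & m = (U_(s) + w - U_(t))%MM.
Proof.
move=> dm le; have := submK le.
set c := (_ - m)%MM => ec.
have /mdeg1P[t /eqP ct] : mdeg c == 1%N.
  by have := congr1 (@mdeg n) ec; rewrite !mdegD mdeg1 dm => /eqP; rewrite eqn_add2r.
exists t; rewrite -ec ct; first by rewrite mnmDE mnm1E eqxx.
by rewrite addmC addmK.
Qed.

Lemma mdeg_move w s t : w t != 0%N -> mdeg (U_(s) + w - U_(t))%MM = mdeg w.
Proof.
move=> wt; have le : (U_(t) <= U_(s) + w)%MM.
  by rewrite lep1mP mnmDE addn_eq0 (negPf wt) andbF.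
by have := congr1 (@mdeg n) (submK le); rewrite !mdegD !mdeg1 addn1 => -[].
Qed.

End Orders.

Section HeadDegree.
Variables (n : nat) (l : 'I_n).
Implicit Types (m w : 'X_{1..n}) (s t : 'I_n).

Definition hdeg m := mdeg (headm l m).

Lemma hdegE m : hdeg m = (\sum_(i : 'I_n | (i <= l)%N) m i)%N.
Proof.
by rewrite /hdeg mdegE [RHS]big_mkcond; apply: eq_bigr => i _; rewrite mnmE.
Qed.

Lemma tdegE m : mdeg (tailm l m) = (\sum_(i : 'I_n | (l < i)%N) m i)%N.
Proof.
by rewrite mdegE [RHS]big_mkcond; apply: eq_bigr => i _; rewrite mnmE.
Qed.

Lemma mdeg_split m : mdeg m = (hdeg m + mdeg (tailm l m))%N.
Proof.
rewrite hdegE tdegE mdegE (bigID (fun i : 'I_n => (i <= l)%N)) /=.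
by congr (_ + _)%N; apply: eq_bigl => i; rewrite ltnNge.
Qed.

Lemma hdegD m1 m2 : hdeg (m1 + m2)%MM = (hdeg m1 + hdeg m2)%N.
Proof. by rewrite !hdegE -big_split; apply: eq_bigr => i _; rewrite mnmDE. Qed.

Lemma hdeg1 s : hdeg U_(s)%MM = (s <= l)%N.
Proof.
rewrite hdegE; under eq_bigr => i _ do rewrite mnm1E.
case: (leqP s l) => sl; last first.
  by rewrite big1 // => i il; rewrite -val_eqE /= gtn_eqF // (leq_ltn_trans il).
rewrite (bigD1 s) //= eqxx big1 // => i /andP[_ /negPf].
by rewrite eq_sym => ->.
Qed.

Lemma hdeg_move w s t : w t != 0%N ->
  (hdeg (U_(s) + w - U_(t)) + (t <= l) = hdeg w + (s <= l))%N.
Proof.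
move=> wt; rewrite -(hdeg1 t) -hdegD submK ?hdegD ?hdeg1 1?addnC //.
by rewrite lep1mP mnmDE addn_eq0 (negPf wt) andbF.
Qed.

Lemma leq_hdeg m s : (s <= l)%N -> (m s <= hdeg m)%N.
Proof. by move=> sl; rewrite hdegE (bigD1 s) //= leq_addr. Qed.

End HeadDegree.

(** * Linear quotients and regularity from closure under moves *)

Section MoveClosed.
Variables (K : fieldType) (n D k : nat) (l : 'I_n) (G : 'X_{1..n} -> Prop).
Variable ms : seq 'X_{1..n}.
Local Notation m_ a := (tnth (in_tuple ms) a).
Implicit Types (a b : 'I_(size ms)) (m w : 'X_{1..n}) (s t : 'I_n).

Hypothesis G_deg : forall w, G w -> mdeg w = D.
Hypothesis G_hdeg : forall w, G w -> (k <= hdeg l w)%N.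
Hypothesis G_move : forall w s t, G w -> w t != 0%N -> (t < s)%N ->
  (k <= hdeg l (U_(s) + w - U_(t)))%N -> G (U_(s) + w - U_(t))%MM.
Hypothesis ms_sorted : sorted (@revlexlt n) ms.
Hypothesis mem_ms : forall w, w \in ms <-> G w.

Lemma G_nth a : G (m_ a). Proof. by apply/mem_ms/mem_tnth. Qed.

Lemma mdeg_nth a : mdeg (m_ a) = D. Proof. exact/G_deg/G_nth. Qed.

Lemma revlexlt_nth a b : (a < b)%N -> revlexlt (m_ a) (m_ b).
Proof.
move=> ab; rewrite !(tnth_nth 0%MM) /=.
apply: (sorted_ltn_nth (@revlexlt_trans n)) => //; exact: ltn_ord.
Qed.

Lemma revlexlt_nthE a b : revlexlt (m_ a) (m_ b) = (a < b)%N.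
Proof.
apply/idP/idP => [lt|]; last exact: revlexlt_nth.
have [//|ba|/val_inj e] := ltngtP a b.
  by have := revlexlt_trans lt (revlexlt_nth ba); rewrite revlexltxx.
by rewrite e revlexltxx in lt.
Qed.

Lemma nth_anti a b : (m_ a <= m_ b)%MM -> a = b.
Proof.
move=> le; have e : m_ a = m_ b.
  have := submK le; have /eqP : mdeg (m_ b - m_ a)%MM = 0%N.
    by have := congr1 (@mdeg n) (submK le); rewrite mdegD !mdeg_nth; clear; lia.
  by rewrite mdeg_eq0 => /eqP->; rewrite add0m.
have [ab|ba|/val_inj//] := ltngtP a b.
  by have := revlexlt_nth ab; rewrite e revlexltxx.
by have := revlexlt_nth ba; rewrite e revlexltxx.
Qed.

(** When x_s w / x_t is an earlier generator: t < s places it before w, and the head degree keeps it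
    in [G]. *)
Definition admissible w s t :=
  [&& (t < s)%N, w t != 0%N & (k <= hdeg l (U_(s) + w - U_(t)))%N].

Lemma admissible_nth a s t : admissible (m_ a) s t ->
  exists2 b : 'I_(size ms), (b < a)%N & m_ b = (U_(s) + m_ a - U_(t))%MM.
Proof.
case/and3P=> ts wt hk; have /mem_ms/(memsP ms)[b e] := G_move (G_nth a) wt ts hk.
by exists b => //; rewrite -revlexlt_nthE -e revlexlt_move.
Qed.

(** By degree, m_b = x_s m_a / x_t for some t; t = s would give m_a itself, and t > s a monomial
    later in the list. *)
Lemma nth_admissible a b s : (b < a)%N -> (m_ b <= U_(s) + m_ a)%MM ->
  exists2 t, admissible (m_ a) s t & m_ b = (U_(s) + m_ a - U_(t))%MM.
Proof.
move=> ba /dvd_degS[|t Ut e]; first by rewrite !mdeg_nth.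
exists t => //; rewrite /admissible -e G_hdeg ?andbT; last exact: G_nth.
have [ts|st|/val_inj ts] := ltngtP t s.
- by move: Ut; rewrite mnmDE mnm1E -(val_eqE s) /= (gtn_eqF ts).
- have wt : m_ a t != 0%N by move: Ut; rewrite mnmDE mnm1E -(val_eqE s) /= (ltn_eqF st).
  have := revlexlt_nth ba; rewrite e => /revlexltP[r [er lr]].
  have := moveE s r wt; have := moveE s t wt; rewrite eqxx.
  rewrite -!(val_eqE s) /= (ltn_eqF st) => et.
  have [rt|tr|/val_inj rt] := ltngtP r t.
  + by have := er t rt; move: et; clear; lia.
  + by rewrite -val_eqE /= (ltn_eqF tr) (ltn_eqF (ltn_trans st tr)); move: lr; clear; lia.
  + by subst r; move: lr et; clear; lia.
- have e' : m_ b = m_ a by rewrite e ts addmC addmK.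
  by have := revlexlt_nth ba; rewrite e' revlexltxx.
Qed.

Lemma lqset_admissible a s :
  reflect (exists t, admissible (m_ a) s t) (s \in lqset K a).
Proof.
apply: (iffP (lqsetP K a s)) => [[b ba /(nth_admissible ba)[t tP _]]|[t tP]].
  by exists t.
have [b ba e] := admissible_nth tP; exists b => //.
by rewrite e lem_subr.
Qed.

Lemma nth_lq a b : (b < a)%N -> exists2 s, s \in lqset K a & (m_ a s < m_ b s)%N.
Proof.
move=> ba; have /revlexltP[s [es lts]] := revlexlt_nth ba.
exists s => //; apply/lqset_admissible.
(* With s in the head, or with h(m_a) > k, any t < s at which m_a has the larger exponent is
   admissible; equality of degrees provides one. *)
have [small|] := boolP ((s <= l)%N || (k < hdeg l (m_ a))%N).
  have [t ts lt_t] : exists2 t : 'I_n, (t < s)%N & (m_ b t < m_ a t)%N.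
    apply: contrapT => noex.
    have : (mdeg (m_ a) < mdeg (m_ b))%N.
      rewrite !mdegE (bigD1 s) //= [X in (_ < X)%N](bigD1 s) //= -addSn leq_add //.
      apply: leq_sum => i si; have [lt|gt|/val_inj e] := ltngtP i s.
      - by rewrite leqNgt; apply/negP => lt_i; apply: noex; exists i.
      - by rewrite es.
      - by rewrite e eqxx in si.
    by rewrite !mdeg_nth ltnn.
  have at0 : m_ a t != 0%N by rewrite -lt0n (leq_ltn_trans _ lt_t).
  exists t; rewrite /admissible ts at0 /=.
  have := hdeg_move l s at0; have := G_hdeg (G_nth a); case/orP: small => [sl|kh].
    by rewrite sl (ltnW (leq_trans ts sl)) => hk /eqP; rewrite eqn_add2r => /eqP->.
  move=> _ e; rewrite -(leq_add2r (t <= l)%N) e; apply: leq_trans (leq_addr _ _).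
  by case: (t <= l)%N; rewrite ?addn1 ?addn0 // ltnW.
rewrite negb_or -ltnNge -leqNgt => /andP[ls hk].
have {}hk : hdeg l (m_ a) = k by apply/eqP; rewrite eqn_leq hk G_hdeg //; apply: G_nth.
(* Now s is in the tail and h(m_a) = k, so t must be in the tail. If m_a had no tail variable before
   s, the tail of m_b would have larger degree and h(m_b) < k. *)
have [[t [ts lt at0]]|noex] := pselect
    (exists t : 'I_n, [/\ (t < s)%N, (l < t)%N & m_ a t != 0%N]).
  exists t; rewrite /admissible ts at0 /= -hk.
  have := hdeg_move l s at0; rewrite (leqNgt t) lt (leqNgt s) ls !addn0 => ->.
  exact: leqnn.
have : (mdeg (tailm l (m_ a)) < mdeg (tailm l (m_ b)))%N.
  rewrite !tdegE (bigD1 s) //= [X in (_ < X)%N](bigD1 s) //= -addSn leq_add //.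
  apply: leq_sum => i /andP[li si]; have [lt|gt|/val_inj e] := ltngtP i s.
  - have [->//|ai] := eqVneq (m_ a i) 0%N; by case: noex; exists i.
  - by rewrite es.
  - by rewrite e eqxx in si.
move: (G_hdeg (G_nth b)) (mdeg_split l (m_ a)) (mdeg_split l (m_ b)).
rewrite !mdeg_nth hk; move: (hdeg _ _) (mdeg _) (mdeg _) => x y z.
by clear; lia.
Qed.

Lemma decomp_admissible a s : s \in lqset K a ->
  exists2 t, admissible (m_ a) s t & m_ (decomp a s) = (U_(s) + m_ a - U_(t))%MM.
Proof. by move=> /decomp_lt/nth_admissible; apply; apply: decomp_le. Qed.

(** Let g(x_s w) = x_s w / x_t, and let t' be admissible for it and r. If x_t' divides w, then t' is
    admissible for w and r, as the move from t to s does not raise the head degree. Otherwise t' =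
    s, and t is admissible, giving the same monomial x_r w / x_t. *)
Lemma nth_reg a s : s \in lqset K a -> lqset K (decomp a s) \subset lqset K a.
Proof.
case/decomp_admissible=> t /and3P[ts wt ht] e; apply/subsetP => r.
case/lqset_admissible=> t' /and3P[tr]; rewrite e => wt' ht'.
apply/lqset_admissible; move: (hdeg_move l s wt) (hdeg_move l r wt') => e1 e2.
have mono : ((s <= l) <= (t <= l))%N.
  by case: (leqP s l) => // sl; rewrite (ltnW (leq_trans ts sl)).
have [w0|wt0] := eqVneq (m_ a t') 0%N.
  have st' : s = t'.
    apply/eqP; move: wt'; apply: contraNT => ne.
    by have := moveE s t' wt; rewrite w0 (negPf ne) => /eqP; rewrite addn_eq0 => /andP[].
  subst t'; exists t; rewrite /admissible (ltn_trans ts tr) wt /=.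
  have := hdeg_move l r wt; move: ht ht' e1 e2.
  move: (hdeg _ _) (hdeg _ _) (hdeg _ _) (hdeg _ _) (s <= l)%N (t <= l)%N (r <= l)%N.
  by clear; lia.
exists t'; rewrite /admissible tr wt0 /=.
have := hdeg_move l r wt0; move: mono ht ht' e1 e2.
move: (hdeg _ _) (hdeg _ _) (hdeg _ _) (hdeg _ _) (s <= l)%N (t <= l)%N (r <= l)%N.
by move: (t' <= l)%N; clear; lia.
Qed.

Lemma decomp_min_admissible a s t : admissible (m_ a) s t ->
    (forall t', admissible (m_ a) s t' -> (t <= t')%N) ->
  m_ (decomp a s) = (U_(s) + m_ a - U_(t))%MM.
Proof.
move=> tP tmin; have [c ca e] := admissible_nth tP.
rewrite (decompP (c := c)) // => [|b le_b]; first by rewrite e lem_subr.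
have [ba|ab] := ltnP b a; last exact: ltnW (leq_trans ca ab).
have [t' t'P e'] := nth_admissible ba le_b.
have := tmin _ t'P; rewrite leq_eqVlt => /orP[/eqP/val_inj tt'|tt'].
  by rewrite (nth_anti (a := c) (b := b)) // e e' tt' lepm_refl.
rewrite ltnW // -revlexlt_nthE e e' revlexlt_move2 //.
by rewrite mnmDE addn_eq0 negb_and; case/and3P: t'P => _ ->; rewrite orbT.
Qed.

End MoveClosed.

(** * Powers of the lexsegment ideal *)

Section TwoVariables.
Variables (n : nat) (l : 'I_n.+1) (V : 'X_{1..n.+1}).
Implicit Types (m : 'X_{1..n.+1}).
Hypothesis ltln : (l < n)%N.
Hypothesis V0 : forall i, i != l -> i != ord_max -> V i = 0%N.

Lemma V0_lt (i : 'I_n.+1) : (i < l)%N -> V i = 0%N.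
Proof.
move=> il; apply: V0; rewrite -val_eqE /=; first by rewrite ltn_eqF.
by rewrite ltn_eqF // (ltn_trans il).
Qed.

Lemma hdeg_eq m : (forall i : 'I_n.+1, (i < l)%N -> m i = 0%N) -> hdeg l m = m l.
Proof.
move=> m0; rewrite hdegE (bigD1 l) //= big1 ?addn0 // => i /andP[il ne].
by apply: m0; rewrite ltn_neqAle il andbT.
Qed.

(** The first difference is not before l, where V vanishes. Beyond l it could only be at the last
    variable, contradicting equality of degrees. So it is at l. *)
Lemma lexlt_hdeg m : mdeg m = mdeg V -> lexlt m V -> (hdeg l m < V l)%N.
Proof.
move=> dm /lexltP[s [es lts]].
have [sl|ls|/val_inj sl] := ltngtP s l.
- by rewrite V0_lt in lts.
- have sM : s = ord_max.
    apply/eqP; apply: contraTT lts => sM; rewrite V0 //.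
    by rewrite -val_eqE /= gtn_eqF.
  suff : (mdeg m < mdeg V)%N by rewrite dm ltnn.
  rewrite !mdegE (bigD1 s) //= [X in (_ < X)%N](bigD1 s) //= -addSn leq_add //.
  apply: leq_sum => i ne; rewrite es // sM ltn_neqAle -ltnS ltn_ord andbT.
  by rewrite sM in ne.
- by subst s; rewrite hdeg_eq // => i il; rewrite es // V0_lt.
Qed.

(** On a tie of head degrees [lexlt_hdeg] excludes m below V, so the tie-break always favours m. *)
Lemma succeqE m : mdeg m = mdeg V -> succeq l m V = (V l <= hdeg l m)%N.
Proof.
move=> dm; rewrite /succeq /prec -/(hdeg l V) -/(hdeg l m) (hdeg_eq V0_lt).
have [lt|lt|eq] := ltngtP (V l) (hdeg l m) => //=.
  by apply/negbTE; apply: contraTneq lt => ->; rewrite hdeg_eq ?ltnn //; apply: V0_lt.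
have [//|ne] := eqVneq m V; first by rewrite orbT.
rewrite orbF; case/orP: (lexlt_total ne) => [/(lexlt_hdeg dm)|->//].
by rewrite eq ltnn.
Qed.

Lemma precE m : mdeg m = mdeg V -> prec l m V = (hdeg l m < V l)%N.
Proof.
move=> dm; rewrite /prec -/(hdeg l V) -/(hdeg l m) (hdeg_eq V0_lt).
have [lt|//|eq] := ltngtP (hdeg l m) (V l) => //=.
by apply/negbTE/negP => /(lexlt_hdeg dm); rewrite eq ltnn.
Qed.

End TwoVariables.

Section LexSegmentPowers.
Variables (n d : nat) (l : 'I_n.+1) (u v a : 'X_{1..n.+1}).
Implicit Types (f m w : 'X_{1..n.+1}) (r s t : 'I_n.+1).
Hypothesis hl : (0 < l < n)%N.
Hypothesis a0 : forall i : 'I_n.+1, (i <= l)%N -> a i = 0%N.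
Hypothesis uE : u = (U_(ord0) + a)%MM.
Hypothesis vE : v = (U_(l) + U_(ord_max) *+ d.-1)%MM.
Hypothesis hu : mdeg u = d.
Hypothesis hv : mdeg v = d.
Local Notation T := (lexseg u v).
Local Notation h := (hdeg l).

Let l_neq_max : (l == ord_max) = false.
Proof. by rewrite -val_eqE /= ltn_eqF //; case/andP: hl. Qed.

Lemma v_two i : i != l -> i != ord_max -> v i = 0%N.
Proof. by move=> il iM; rewrite vE mnmDE mulmnE !mnm1E eq_sym (negPf il) eq_sym (negPf iM). Qed.

Lemma v_l : v l = 1%N.
Proof. by rewrite vE mnmDE mulmnE !mnm1E eqxx eq_sym l_neq_max. Qed.

Lemma lexseg_deg w : T w -> mdeg w = d.
Proof. by case=> ->. Qed.

(** The monomial x_l x_n^(d-1) is the lexicographically least one of degree d with a variable in its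
    head. *)
Lemma lexle_v w : mdeg w = d -> lexle v w = (0 < h w)%N.
Proof.
case/andP: hl => l0 ln dw; rewrite lexleNgt; apply/idP/idP => [|hw].
  apply: contraR; rewrite -eqn0Ngt => /eqP h0; apply/lexltP; exists l.
  have w0 (i : 'I_n.+1) : (i <= l)%N -> w i = 0%N.
    by move=> il; apply/eqP; rewrite -leqn0 -h0 leq_hdeg.
  split=> [i il|]; last by rewrite w0 // v_l.
  by rewrite w0 ?(ltnW il) // (V0_lt ln v_two).
by apply/negP => /(lexlt_hdeg ln v_two); rewrite dw hv v_l => /(_ erefl); rewrite ltnS leqNgt hw.
Qed.

Lemma u0 : u ord0 = 1%N.
Proof. by rewrite uE mnmDE mnm1E eqxx a0. Qed.

Lemma h_u : h u = 1%N.
Proof.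
rewrite uE hdegD hdeg1 leq0n /= hdegE big1 ?addn0 // => i; exact: a0.
Qed.

Lemma lexseg_hdeg w : T w -> (0 < h w)%N.
Proof. by case=> dw _; rewrite lexle_v // dw. Qed.

Lemma lexseg_ord0 w : T w -> (w ord0 <= 1)%N.
Proof.
case=> _ /orP[/eqP->|/lexltP[s [es lts]]] _; first by rewrite u0.
have [s0|s0] := posnP s; last by rewrite es // u0.
by rewrite ltnW // -u0; have -> : ord0 = s by apply: val_inj.
Qed.

(** The head of u is x_1 alone, so a smaller monomial divisible by x_1 first differs from u beyond
    l. *)
Lemma lexseg_hdeg1 w : T w -> w ord0 != 0%N -> h w = 1%N.
Proof.
case=> _ /orP[/eqP->|/lexltP[s [es lts]]] _ w0; first exact: h_u.
have sl : (l < s)%N.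
  rewrite ltnNge; apply/negP => sl; have [s0|s0] := posnP s.
    have e : s = ord0 by apply: val_inj.
    by move: lts w0; rewrite e u0 ltnS leqn0 => ->.
  by move: lts; rewrite uE mnmDE mnm1E a0 // -val_eqE /= (ltn_eqF s0).
by rewrite -h_u !hdegE; apply: eq_bigr => i il; apply: es; apply: leq_ltn_trans sl.
Qed.

Lemma lexseg_free w : mdeg w = d -> (0 < h w)%N -> w ord0 = 0%N -> T w.
Proof.
move=> dw hw w0; split; rewrite ?hu ?lexle_v //; apply: lexltW.
by apply/lexltP; exists ord0; rewrite w0 u0.
Qed.

Lemma lexseg_move w s t : T w -> w t != 0%N -> (t < s)%N ->
  (0 < h (U_(s) + w - U_(t)))%N -> T (U_(s) + w - U_(t))%MM.
Proof.
move=> Tw wt ts hw; have dw := lexseg_deg Tw; case: (Tw) => _ wu _.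
split; rewrite ?hu ?lexle_v ?mdeg_move //.
exact/lexltW/(lexlt_le_trans (lexlt_move wt ts)).
Qed.

(** The result may be larger than w, but it is free of x_1 and so stays below u: if x_1 divides w,
    it is the whole head and is the variable removed. *)
Lemma lexseg_swap w r t : T w -> w t != 0%N -> (t <= l)%N -> (0 < r <= l)%N ->
  T (U_(r) + w - U_(t))%MM.
Proof.
move=> Tw wt tl /andP[r0 rl]; apply: lexseg_free.
- by rewrite mdeg_move // (lexseg_deg Tw).
- by have := hdeg_move l r wt; rewrite rl tl => /eqP; rewrite eqn_add2r => /eqP->; apply: lexseg_hdeg.
have := moveE r ord0 wt; rewrite -(val_eqE r) /= (gtn_eqF r0) add0n.
have := lexseg_ord0 Tw; have [w0|w0] := eqVneq (w ord0) 0%N.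
  by rewrite w0 => _ /eqP; rewrite addn_eq0 => /andP[/eqP].
have [<-|t0] := eqVneq t ord0; first by rewrite addn1 => le1 e; move: le1; rewrite -e ltnS leqn0 => /eqP.
have := lexseg_hdeg1 Tw w0; rewrite hdegE (bigD1 ord0) //= (bigD1 t) ?tl //= => e.
by move: e w0 wt; clear; lia.
Qed.

Lemma prodset_hdeg k w : prodset T k w -> (k <= h w)%N.
Proof.
elim: k w => [|k IH] w //= [m1 [m2 [/lexseg_hdeg h1 /IH h2 ->]]].
by rewrite hdegD -add1n leq_add.
Qed.

Lemma prodset_ord0 k w : prodset T k w -> (w ord0 <= k)%N.
Proof.
elim: k w => [|k IH] w /=; first by move=> ->; rewrite mnm0E.
by move=> [m1 [m2 [/lexseg_ord0 h1 /IH h2 ->]]]; rewrite mnmDE -(add1n k) leq_add.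
Qed.

Lemma moveDl m1 m2 s t : m1 t != 0%N ->
  (U_(s) + (m1 + m2) - U_(t) = (U_(s) + m1 - U_(t)) + m2)%MM.
Proof.
move=> mt; apply/mnmP => i; have := moveE s i mt.
have mt' : (m1 + m2)%MM t != 0%N by rewrite mnmDE addn_eq0 (negPf mt).
by have := moveE s i mt'; rewrite !mnmDE; clear; lia.
Qed.

Lemma moveDr m1 m2 s t : m2 t != 0%N ->
  (U_(s) + (m1 + m2) - U_(t) = m1 + (U_(s) + m2 - U_(t)))%MM.
Proof. by move=> mt; rewrite [(m1 + m2)%MM]addmC moveDl // addmC. Qed.

Lemma move2 m1 m2 r s t : m1 t != 0%N -> m2 r != 0%N ->
  (U_(s) + (m1 + m2) - U_(t) = (U_(r) + m1 - U_(t)) + (U_(s) + m2 - U_(r)))%MM.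
Proof.
move=> mt mr; apply/mnmP => i; have := moveE r i mt; have := moveE s i mr.
have mt' : (m1 + m2)%MM t != 0%N by rewrite mnmDE addn_eq0 (negPf mt).
by have := moveE s i mt'; rewrite !mnmDE; clear; lia.
Qed.

Lemma prodset_swap k w r t : prodset T k w -> w t != 0%N -> (t <= l)%N ->
  (0 < r <= l)%N -> prodset T k (U_(r) + w - U_(t))%MM.
Proof.
move=> + + tl rl; elim: k w => [|k IH] w /=; first by move=> ->; rewrite mnm0E.
move=> [m1 [m2 [T1 T2 ->]]]; rewrite mnmDE addn_eq0 negb_and.
have [mt _|mt /= mt2] := boolP (m1 t != 0%N).
  by rewrite moveDl //; exists (U_(r) + m1 - U_(t))%MM, m2; split=> //; apply: lexseg_swap.
rewrite moveDr //; exists m1, (U_(r) + m2 - U_(t))%MM; split=> //; exact: IH.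
Qed.

Lemma ex_head m : (m ord0 < h m)%N -> exists2 r : 'I_n.+1, (0 < r <= l)%N & m r != 0%N.
Proof.
move=> hm; apply: contrapT => no; move: hm; rewrite hdegE (bigD1 ord0) //= big1 ?addn0 ?ltnn //.
move=> i /andP[il i0]; apply/eqP/negPn/negP => mi; apply: no; exists i => //.
by rewrite il lt0n -[X in X != _]/(val i) i0.
Qed.

(* When moving x_t to x_s would kill the head of the factor containing x_t,   *)
(* another factor has head degree at least 2; a variable x_r, r > 0, of its   *)
(* head is traded for x_t.                                                    *)
Lemma prodset_move k w s t : prodset T k w -> w t != 0%N -> (t < s)%N ->
  (k <= h (U_(s) + w - U_(t)))%N -> prodset T k (U_(s) + w - U_(t))%MM.
Proof.
elim: k w t => [|k IH] w t /=; first by move=> ->; rewrite mnm0E.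
move=> [m1 [m2 [T1 T2 ->]]] wt ts hw.
have e := hdeg_move l s wt; rewrite hdegD in e.
have [h1 h2] := (lexseg_hdeg T1, prodset_hdeg T2).
have [m1t|m1t] := boolP (m1 t != 0%N).
  have e1 := hdeg_move l s m1t.
  have [hm1|hm1] := posnP (h (U_(s) + m1 - U_(t))%MM); last first.
    by rewrite moveDl //; exists (U_(s) + m1 - U_(t))%MM, m2; split=> //; apply: lexseg_move.
  have tl : (t <= l)%N by move: hm1 e1 h1; case: (t <= l)%N; clear; lia.
  have sl : (s <= l)%N = false by move: hm1 e1 h1; rewrite tl; case: (s <= l)%N; clear; lia.
  have ltk : (k < h m2)%N by move: e e1 hm1 hw; rewrite tl sl; clear; lia.
  have [r rl m2r] := ex_head (leq_ltn_trans (prodset_ord0 T2) ltk).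
  have rs : (r < s)%N by case/andP: rl => _ rl; rewrite ltnNge; apply/negP => /leq_trans/(_ rl); rewrite sl.
  rewrite (move2 (r := r)) //; eexists; eexists; split; last by [].
    exact: lexseg_swap.
  apply: IH => //; have := hdeg_move l s m2r; case/andP: rl => _ ->; rewrite sl.
  by move: ltk; clear; lia.
have m2t : m2 t != 0%N by move: wt m1t; rewrite mnmDE addn_eq0 negb_and => /orP[->|].
have e2 := hdeg_move l s m2t.
have [hm2|hm2] := leqP k (h (U_(s) + m2 - U_(t))%MM).
  by rewrite moveDr //; exists m1, (U_(s) + m2 - U_(t))%MM; split=> //; apply: IH.
have tl : (t <= l)%N by move: hm2 e2 h2; case: (t <= l)%N; clear; lia.
have sl : (s <= l)%N = false by move: hm2 e2 h2; rewrite tl; case: (s <= l)%N; clear; lia.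
have lt1 : (1 < h m1)%N by move: e e2 hm2 hw h2; rewrite tl sl; clear; lia.
have [r rl m1r] := ex_head (leq_ltn_trans (lexseg_ord0 T1) lt1).
have rs : (r < s)%N by case/andP: rl => _ rl; rewrite ltnNge; apply/negP => /leq_trans/(_ rl); rewrite sl.
exists (U_(s) + m1 - U_(r))%MM, (U_(r) + m2 - U_(t))%MM; split; last first.
- by rewrite [(m1 + m2)%MM]addmC (move2 (r := r)) // addmC.
- exact: prodset_swap.
apply: lexseg_move => //; have := hdeg_move l s m1r; case/andP: rl => _ ->; rewrite sl.
by move: lt1; clear; lia.
Qed.

End LexSegmentPowers.

(** * Completely lexsegment ideals *)

Section Shadows.
Variable n : nat.
Implicit Types (u v m w : 'X_{1..n.+1}) (i j s t : 'I_n.+1).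

Lemma lexlt_add2l c m1 m2 : lexlt (c + m1)%MM (c + m2)%MM = lexlt m1 m2.
Proof.
apply/lexltP/lexltP => -[s [es lts]]; exists s; split=> [i /es|].
- by rewrite !mnmDE => /eqP; rewrite eqn_add2l => /eqP.
- by move: lts; rewrite !mnmDE ltn_add2l.
- by rewrite !mnmDE => ->.
- by rewrite !mnmDE ltn_add2l.
Qed.

Lemma lexle_add2l c m1 m2 : lexle (c + m1)%MM (c + m2)%MM = lexle m1 m2.
Proof. by rewrite !lexleNgt lexlt_add2l. Qed.

Lemma lexle_addU i j m : (i <= j)%N -> lexle (U_(j) + m)%MM (U_(i) + m)%MM.
Proof.
rewrite leq_eqVlt => /orP[/eqP/val_inj->|ij]; first exact: lexle_refl.
apply/lexltW/lexltP; exists i; split=> [s si|].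
  by rewrite !mnmDE !mnm1E -!val_eqE /= (gtn_eqF si) (gtn_eqF (ltn_trans si ij)).
by rewrite !mnmDE !mnm1E eqxx -val_eqE /= (gtn_eqF ij) ltn_add2r.
Qed.

Lemma lexlt_ord0 m1 m2 : (m1 ord0 < m2 ord0)%N -> lexlt m1 m2.
Proof. by move=> lt0; apply/lexltP; exists ord0. Qed.

Lemma lexlt_ord0_eq0 m v : lexlt m v -> v ord0 = 0%N -> m ord0 = 0%N.
Proof.
move=> /lexltP[s [es lts]] v0; have [s0|s0] := posnP s; last by rewrite es.
by have e : s = ord0 by [apply: val_inj]; rewrite e v0 in lts.
Qed.

Lemma mdeg_gt0_ex m : (0 < mdeg m)%N -> exists i, m i != 0%N.
Proof.
rewrite mdegE lt0n sum_nat_eq0 negb_forall => /existsP[i].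
by rewrite implyTb => mi; exists i.
Qed.

(* The criterion of De Negri and Herzog for (L(u,v)) to be completely         *)
(* lexsegment, in the case x_1 | u, x_1 not dividing v.                       *)
Definition shad_cond u v := forall m, mdeg m = mdeg v -> lexlt m v ->
  exists2 i, m i != 0%N & lexle (U_(ord0) + m - U_(i))%MM u.

(** To write w as x_i m with m in the segment, x_1 is removed if it divides w, with [shad_cond]
    repairing the case where the quotient falls below v. Otherwise the last variable of w is
    removed. *)
Lemma shad_lexseg u v w : mdeg u = mdeg v -> u ord0 != 0%N -> v ord0 = 0%N ->
    shad_cond u v ->
  shad (lexseg u v) w <-> lexseg (U_(ord0) + u)%MM (U_(ord_max) + v)%MM w.
Proof.
move=> duv u0 v0 C; split.
  move=> [i [m [[dm mu vm] ->]]]; split; first by rewrite !mdegD !mdeg1 dm.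
    by apply: (lexle_trans _ (@lexle_addU ord0 i u (leq0n i))); rewrite lexle_add2l.
  by apply: (lexle_trans (@lexle_addU i ord_max v (leq_ord i))); rewrite lexle_add2l.
move=> [dw wu vw]; have [w0|w0] := eqVneq (w ord0) 0%N; last first.
  have ew : w = (U_(ord0) + (w - U_(ord0)))%MM by rewrite [RHS]addmC submK // lep1mP.
  move: (w - U_(ord0))%MM ew => m ew; subst w.
  rewrite lexle_add2l in wu; move/eqP: dw; rewrite !mdegD !mdeg1 eqn_add2l => /eqP dm.
  have [vm|] := boolP (lexle v m); first by exists ord0, m.
  rewrite lexleNgt negbK => mv; have [|i mi le_u] := C m _ mv; first by rewrite dm.
  exists i, (U_(ord0) + m - U_(i))%MM; split; last first.
    by rewrite [RHS]addmC submK // lep1mP mnmDE addn_eq0 (negPf mi) andbF.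
  split; rewrite ?mdeg_move //; apply: lexltW; apply: lexlt_ord0.
  have i0 : i != ord0 by apply: contraNneq mi => ->; rewrite (lexlt_ord0_eq0 mv).
  by have := moveE ord0 ord0 mi; rewrite eqxx (negPf i0) addn0 v0 => ->.
have [i0 wi0] : exists i, w i != 0%N by apply: mdeg_gt0_ex; rewrite dw mdegD mdeg1.
have [i wi imax] := arg_maxnP (@nat_of_ord n.+1) (wi0 : (fun i => w i != 0%N) i0).
have ew : w = (U_(i) + (w - U_(i)))%MM by rewrite [RHS]addmC submK // lep1mP.
exists i, (w - U_(i))%MM; split=> //; move: (w - U_(i))%MM ew => m ew; subst w.
have dm : mdeg m = mdeg u by move: dw; rewrite !mdegD !mdeg1 => -[].
have m0 : m ord0 = 0%N by move: w0; rewrite mnmDE => /eqP; rewrite addn_eq0 => /andP[_ /eqP].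
split=> //; first by apply/lexltW/lexlt_ord0; rewrite m0 lt0n.
rewrite lexleNgt; apply/negP => /lexltP[s [es lts]].
(* A first difference before i would put w below x_n v; from i on, m has no later variable and its
   degree would be too small. *)
have [si|is_] := ltnP s i.
  move: vw; rewrite lexleNgt => /negP; apply; apply/lexltP; exists s.
  have lt_max (j : 'I_n.+1) : (j <= s)%N -> (ord_max == j) = false.
    by move=> js; rewrite -val_eqE /= gtn_eqF // (leq_ltn_trans js) // (leq_trans si) // -ltnS ltn_ord.
  split=> [j js|]; rewrite !mnmDE !mnm1E lt_max //=.
  - by rewrite -val_eqE /= gtn_eqF ?(ltn_trans js) // es.
  - exact: ltnW.
  - by rewrite -val_eqE /= gtn_eqF.
have : (mdeg m < mdeg v)%N.
  rewrite !mdegE (bigD1 s) //= [X in (_ < X)%N](bigD1 s) //= -addSn leq_add //.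
  apply: leq_sum => j js; have [ltj|gtj|/val_inj e] := ltngtP j s.
  - by rewrite es.
  - have : ~~ ((U_(i) + m)%MM j != 0%N).
      by apply/negP => /imax ji; have := leq_ltn_trans (leq_trans ji is_) gtj; rewrite ltnn.
    by rewrite negbK mnmDE addn_eq0 => /andP[_ /eqP->].
  - by rewrite e eqxx in js.
by rewrite dm duv ltnn.
Qed.

Lemma shad_ext (T T' : 'X_{1..n.+1} -> Prop) w :
  (forall m, T m <-> T' m) -> shad T w <-> shad T' w.
Proof.
by move=> e; split=> -[i [m [Tm ->]]]; exists i, m; split=> //; apply/e.
Qed.

(** After one shadow the condition is automatic: x_1^2 divides the new upper end, while x_1 m / x_i
    has exponent one in x_1. *)
Lemma shad_cond_completely_lexsegment u v : (0 < n)%N -> mdeg u = mdeg v ->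
  u ord0 != 0%N -> v ord0 = 0%N -> shad_cond u v -> completely_lexsegment_set (lexseg u v).
Proof.
move=> n0 duv u0 v0 C.
have H (i : nat) : exists u' v', [/\ mdeg u' = mdeg v', u' ord0 != 0%N, v' ord0 = 0%N,
    shad_cond u' v' & forall w, iter i (@shad n.+1) (lexseg u v) w <-> lexseg u' v' w].
  elim: i => [|i [u' [v' [d' u0' v0' C' E]]]]; first by exists u, v.
  exists (U_(ord0) + u')%MM, (U_(ord_max) + v')%MM; split.
  - by rewrite !mdegD !mdeg1 d'.
  - by rewrite mnmDE mnm1E eqxx.
  - by rewrite mnmDE mnm1E v0' -val_eqE /= gtn_eqF.
  - move=> m dm mv; have [|i1 mi] := @mdeg_gt0_ex m; first by rewrite dm mdegD mdeg1.
    have v1 : (U_(ord_max) + v')%MM ord0 = 0%N by rewrite mnmDE mnm1E v0' -val_eqE /= gtn_eqF.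
    exists i1 => //; apply/lexltW/lexlt_ord0.
    have i10 : i1 != ord0 by apply: contraNneq mi => ->; rewrite (lexlt_ord0_eq0 mv v1).
    have := moveE ord0 ord0 mi; rewrite eqxx (negPf i10) addn0 (lexlt_ord0_eq0 mv v1) => ->.
    by rewrite mnmDE mnm1E eqxx ltnS addn0 lt0n.
  - move=> w; rewrite iterS; apply: (iff_trans (shad_ext w E)); exact: shad_lexseg.
have HL (i : nat) : lexsegment_set (iter i (@shad n.+1) (lexseg u v)).
  have [u' [v' [d' u0' v0' C' E]]] := H i; exists u', v'; split=> //.
  by apply/lexltW/lexlt_ord0; rewrite v0' lt0n.
by split; first exact: (HL 0%N).
Qed.

Lemma lexle_max m : lexle (U_(ord_max) *+ mdeg m)%MM m.
Proof.
rewrite lexleNgt; apply/negP => /lexltP[s [es lts]].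
have e : s = ord_max.
  apply/eqP; apply: contraTT lts => /negPf ne.
  by rewrite mulmnE mnm1E eq_sym ne.
move: lts; rewrite e mulmnE mnm1E eqxx mul1n mdegE (bigD1 ord_max) //= big1 ?addn0 ?ltnn //.
move=> i /negPf ne; rewrite es ?mulmnE ?mnm1E 1?eq_sym ?ne // e.
by rewrite ltn_neqAle -ltnS ltn_ord andbT; move: ne; rewrite -val_eqE => /negbT.
Qed.

End Shadows.

(** * The shape of u and v *)

Section Shape.
Variables (K : fieldType) (n d : nat) (u v : 'X_{1..n.+1}).
Local Notation I := (mon_ideal (lexseg u v) : {mpoly K[n.+1]} -> Prop).
Hypothesis hd : (2 <= d)%N.
Hypothesis hu : mdeg u = d.
Hypothesis hv : mdeg v = d.
Hypothesis u0 : u ord0 != 0%N.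
Hypothesis v0 : v ord0 = 0%N.

Lemma n_gt0 : (0 < n)%N.
Proof.
rewrite lt0n; apply/eqP => n0; move: hd; rewrite -hv mdegE big1 // => i _.
suff -> : i = ord0 by [].
by apply/val_inj/eqP; rewrite /= -leqn0 -ltnS; case: i => /= i; rewrite n0.
Qed.

(* No element of L(u,v) can precede v: removing x_t from x_j v with t < j     *)
(* leads below v in the lexicographical order.                                *)
Lemma lexseg_revlex_least w : revlex_linear_quotients I -> lexseg u v w ->
  w = v \/ revlexlt v w.
Proof.
move=> [ms [[ms_s ms_I] lq]] Tw.
have mem_ms m : m \in ms <-> lexseg u v m.
  apply: (iff_trans (ms_I m)); apply: (@mingen_equigenerated _ _ _ d) => m' [-> _ _].
  exact: hu.
have Tv : lexseg u v v.
  by split; rewrite ?hu ?lexle_refl //; apply/lexltW/lexlt_ord0; rewrite v0 lt0n.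
have /(memsP ms)[a ea] := (mem_ms v).2 Tv; have /(memsP ms)[b eb] := (mem_ms w).2 Tw.
have degT m : lexseg u v m -> mdeg m = d by case=> ->.
have [ab|ba|/val_inj ab] := ltngtP a b; last by left; rewrite eb -ab.
  by right; rewrite ea eb; apply: revlexlt_nth ab.
have [A PA] := lq a (leq_ltn_trans (leq0n b) ba).
have /PA/mon_ideal_varset/mon_idealX[_ [j jA _] _] : lqcolon a ('X_[w] : {mpoly K[n.+1]}).
  rewrite /lqcolon /colon -mpolyXD; apply/mon_idealX; exists w; last exact: lem_addr.
  by apply/mem_takeP; exists b.
have /lqsetP[c ca le_c] : j \in lqset K a.
  rewrite inE; apply/asboolP/PA/mon_ideal_varset/mon_idealX.
  by exists U_(j)%MM; rewrite ?lepm_refl //; exists j.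
have [t /and3P[tj vt _] e] :=
  @nth_admissible _ d 0 ord0 _ ms degT (fun _ _ => leq0n _) ms_s mem_ms a c j ca le_c.
have /mem_ms[_ _] := mem_tnth c (in_tuple ms).
by rewrite e -ea lexleNgt lexlt_move // ea.
Qed.

Lemma lexseg_shape : revlex_linear_quotients I -> ~ completely_lexsegment_ideal I ->
  exists l : 'I_n.+1, [/\ (0 < l < n)%N,
    forall i : 'I_n.+1, (i <= l)%N -> (u - U_(ord0))%MM i = 0%N
  & v = (U_(l) + U_(ord_max) *+ d.-1)%MM].
Proof.
move=> hlq hncl; have n0 := n_gt0.
have max0 : (ord0 == ord_max :> 'I_n.+1) = false by rewrite -val_eqE /= ltn_eqF.
(* Such an m exists because otherwise [shad_cond] would hold and I would be completely
   lexsegment. *)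
have [m [dm mv mu]] : exists m, [/\ mdeg m = d, lexlt m v &
    forall i, m i != 0%N -> lexlt u (U_(ord0) + m - U_(i))%MM].
  apply: contrapT => no; apply: hncl; exists (lexseg u v); split=> //.
  apply: shad_cond_completely_lexsegment; rewrite ?hu // => m; rewrite hv => dm mv.
  apply: contrapT => noi; apply: no; exists m; split=> // i mi.
  by rewrite -[lexlt _ _]negbK -lexleNgt; apply/negP => le; apply: noi; exists i.
have eu : u = (U_(ord0) + (u - U_(ord0)))%MM by rewrite [RHS]addmC submK // lep1mP.
have du : mdeg (u - U_(ord0))%MM = d.-1 by move: hu; rewrite {1}eu mdegD mdeg1 => <-.
(* The test element x_1 x_n^(d-1) is the lexicographically least multiple of x_1 of degree d, hence
   in the segment; v preceding it forces the exponent of x_n in v. *)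
have vmax : (d.-1 <= v ord_max)%N.
  have [||e|/revlexltP[s [es lts]]] := @lexseg_revlex_least (U_(ord0) + U_(ord_max) *+ d.-1)%MM.
  - by [].
  - split.
    + by rewrite mdegD mdegMn !mdeg1 hu mul1n; case: d hd.
    + by rewrite [X in lexle _ X]eu lexle_add2l -du lexle_max.
    + by apply/lexltW/lexlt_ord0; rewrite mnmDE mnm1E v0.
  - by move: v0; rewrite -e mnmDE mnm1E eqxx.
  have sM : (s <= (ord_max : 'I_n.+1))%N by rewrite -ltnS ltn_ord.
  have e : (U_(ord0) + U_(ord_max) *+ d.-1)%MM (ord_max : 'I_n.+1) = d.-1.
    by rewrite mnmDE mulmnE !mnm1E eqxx max0 mul1n.
  have [sE|/es->] := leqP (ord_max : 'I_n.+1) s; last by rewrite e.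
  have sm : s = ord_max by apply/val_inj/eqP; rewrite eqn_leq sE sM.
  by rewrite sm e in lts; apply: ltnW.
have le_v : (U_(ord_max) *+ d.-1 <= v)%MM.
  apply/mnm_lepP => i; rewrite mulmnE mnm1E; have [e|_] := eqVneq ord_max i; last by rewrite mul0n.
  by rewrite mul1n -e.
have ev := submK le_v; move: (v - _)%MM ev => c ev.
have /mdeg1P[l /eqP el] : mdeg c == 1%N.
  by move: hv hd; rewrite -ev mdegD mdegMn mdeg1 mul1n; clear; case: d => // d'; lia.
have vE : v = (U_(l) + U_(ord_max) *+ d.-1)%MM by rewrite -ev el.
have l0 : (0 < l)%N.
  rewrite lt0n; apply/eqP => l0; have e : l = ord0 by apply: val_inj.
  by move: v0; rewrite vE e mnmDE mnm1E eqxx.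
have ln : (l < n)%N.
  rewrite ltn_neqAle -ltnS ltn_ord andbT; apply/eqP => l_n.
  have e : l = ord_max by apply: val_inj.
  (* Were l last, v = x_n^d would be the least monomial and m could not lie below it. *)
  have vM : v = (U_(ord_max) *+ mdeg m)%MM.
    by rewrite vE e dm -mulmS prednK // (ltn_trans _ hd).
  by have := lexle_max m; rewrite -vM lexleNgt mv.
exists l; split=> //; first by rewrite l0 ln.
have V0 : forall i, i != l -> i != ord_max -> v i = 0%N.
  move=> i il iM; rewrite vE mnmDE mulmnE !mnm1E eq_sym (negPf il).
  by rewrite eq_sym (negPf iM).
have vl : v l = 1%N.
  by rewrite vE mnmDE mulmnE !mnm1E eqxx -val_eqE /= (gtn_eqF ln).
have m0 (i : 'I_n.+1) : (i <= l)%N -> m i = 0%N.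
  move=> il; apply/eqP; rewrite -leqn0 -ltnS -vl.
  apply: leq_ltn_trans (leq_hdeg m il) (lexlt_hdeg ln V0 _ mv); by rewrite dm hv.
have [|i mi] := @mdeg_gt0_ex _ m; first by rewrite dm (ltn_trans _ hd).
have em : (U_(ord0) + m - U_(i) = U_(ord0) + (m - U_(i)))%MM.
  by rewrite addmBA // lep1mP.
(* Cancelling x_1 leaves u/x_1 below m/x_i. The latter has no head, so the first difference lies
   beyond l and u/x_1 has no head either. *)
have := mu i mi; rewrite em {1}eu lexlt_add2l => /lexltP[s [es lts]] j jl.
have mB r : (m - U_(i))%MM r = (m r - (i == r))%N by rewrite mnmBE mnm1E.
have ls : (l < s)%N.
  by rewrite ltnNge; apply: contraTN lts => sl; rewrite mB m0.
by rewrite es ?mB ?m0 // (leq_ltn_trans jl).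
Qed.

End Shape.

(** * The least variable that can be removed *)

Section MinimalMove.
Variables (n k : nat) (l : 'I_n.+1).
Implicit Types (m w : 'X_{1..n.+1}) (s t : 'I_n.+1).

Lemma minvarP m t : m t != 0%N ->
  m (minvar m) != 0%N /\ forall j : 'I_n.+1, m j != 0%N -> (minvar m <= j)%N.
Proof.
move=> mt; rewrite /minvar; case: pickP => [i /andP[mi /forallP mlt]|no] /=.
  split=> // j mj; rewrite leqNgt; apply: contraNN mj => ji.
  by move: (mlt j); rewrite ji.
have [i mi imin] := arg_minnP (@nat_of_ord n.+1) (mt : (fun i => m i != 0%N) t).
have := no i; rewrite mi /= => /negbT/negP[]; apply/forallP => j; apply/implyP.
by apply: contraTT => /imin; rewrite -leqNgt.
Qed.

Lemma admissible_minvar w s t : admissible k l w s t ->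
    (k <= hdeg l (U_(s) + w - U_(minvar w)))%N ->
  admissible k l w s (minvar w) /\
  forall t', admissible k l w s t' -> (minvar w <= t')%N.
Proof.
case/and3P=> ts wt _ hk; have [w0 wmin] := minvarP wt; split.
  by rewrite /admissible w0 hk (leq_ltn_trans (wmin t wt)).
by move=> t' /and3P[_ /wmin].
Qed.

(** All head variables cost the same head degree, so if x_min(w) cannot be removed, no head variable
    can; removing any tail variable costs none. *)
Lemma admissible_minvar_tail w s t : admissible k l w s t ->
    (hdeg l (U_(s) + w - U_(minvar w)) < k)%N ->
  admissible k l w s (minvar (tailm l w)) /\
  forall t', admissible k l w s t' -> (minvar (tailm l w) <= t')%N.
Proof.
move=> tP hk.
have tailE (i : 'I_n.+1) : (l < i)%N -> tailm l w i = w i by rewrite mnmE => ->.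
have lt t' : admissible k l w s t' -> (l < t')%N.
  case/and3P=> _ wt'; rewrite ltnNge; apply: contraTN => tl.
  have [w0 wmin] := minvarP wt'; rewrite -ltnNge; apply: leq_trans hk.
  have := hdeg_move l s wt'; have := hdeg_move l s w0.
  by rewrite tl (leq_trans (wmin _ wt') tl) => <- /eqP; rewrite eqn_add2r => /eqP->.
have tail_neq0 t' : admissible k l w s t' -> tailm l w t' != 0%N.
  by move=> t'P; rewrite tailE ?lt //; case/and3P: t'P.
have [q0 qmin] := minvarP (tail_neq0 _ tP); set q := minvar _ in q0 qmin *.
have lq : (l < q)%N by move: q0; rewrite mnmE; case: (l < q)%N.
split=> [|t' /tail_neq0/qmin //]; have wq : w q != 0%N by rewrite -tailE.
rewrite /admissible wq (leq_ltn_trans (qmin t (tail_neq0 _ tP))) /=; last by case/and3P: tP.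
case/and3P: (tP) => ts wt; have := hdeg_move l s wt; have := hdeg_move l s wq.
by rewrite (leqNgt q) lq (leqNgt t) (lt _ tP) !addn0 => -> ->.
Qed.

End MinimalMove.

Lemma subm_sub n (m1 m2 : 'X_{1..n}) : (m2 <= m1)%MM -> (m1 - (m1 - m2) = m2)%MM.
Proof. by move=> le; rewrite submBA // addmC addmK. Qed.

Lemma eq_mingen (K : fieldType) n (J J' : {mpoly K[n]} -> Prop) m :
  (forall p, J p <-> J' p) -> mingen J m <-> mingen J' m.
Proof.
by move=> e; split=> -[/e Jm mmin]; split=> // m' le /e; apply: mmin.
Qed.

Lemma big_split_cond (V : zmodType) (I : finType) (A : {set I}) (P Q : pred I) (E F G : I -> V) :
    (forall s, s \in A -> Q s = ~~ P s) ->
    (forall s, s \in A -> P s -> E s = F s) ->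
    (forall s, s \in A -> Q s -> E s = G s) ->
  \sum_(s in A) E s = \sum_(s in A | P s) F s + \sum_(s in A | Q s) G s.
Proof.
move=> QP EF EG; rewrite (bigID P) /=; congr (_ + _).
  by apply: eq_bigr => s /andP[sA Ps]; apply: EF.
apply: eq_big => [s|s /andP[sA nPs]]; last by apply: EG; rewrite ?QP.
by have [/QP->|] := boolP (s \in A).
Qed.

Theorem corollary2p15 (K : fieldType) (n d : nat) (u v : 'X_{1..n.+1})
    (I : {mpoly K[n.+1]} -> Prop := mon_ideal (lexseg u v))
    (hd : (2 <= d)%N) (hu : mdeg u = d) (hv : mdeg v = d)
    (huv : lexlt v u)
    (hu1 : (U_(ord0) <= u)%MM) (hv1 : ~~ (U_(ord0) <= v)%MM)
    (hlq : revlex_linear_quotients I)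
    (hncl : ~ completely_lexsegment_ideal I) :
  exists l : 'I_n.+1,
    [/\ (0 < l < n)%N,
        exists a : 'X_{1..n.+1},
          (forall i : 'I_n.+1, (i <= l)%N -> a i = 0%N) /\
          u = (U_(ord0) + a)%MM,
        v = (U_(l) + U_(ord_max) *+ d.-1)%MM
      & forall (k : nat) (ms : seq 'X_{1..n.+1}),
          (1 <= k)%N -> revlex_listing (ideal_pow I k) ms ->
        exists del : forall i, {linear freeS K n.+1 (Fbasis K ms i.+1) ->
                                       freeS K n.+1 (Fbasis K ms i)},
        [/\ minimal_graded_free_resolution (@Fdeg K n.+1 ms) del
              (ideal_pow I k),
            iterated_mapping_cone del,
            forall w : 'X_{1..n.+1}, w \in ms ->
              del 0%N (fsymb K ms 0 set0 w) = [ffun=> 'X_[w]]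
          & forall (i : nat) (a : 'I_(size ms)) (sigma : {set 'I_n.+1})
                (w := tnth (in_tuple ms) a) (wt := tailm l w),
              sigma \subset lqset K a -> #|sigma| = i.+1 ->
              del i.+1 (fsymb K ms i.+1 sigma w) =
                \sum_(s in sigma | succeq l (U_(s) + w - U_(minvar w))%MM
                                             (v *+ k)%MM)
                  (((-1) ^+ alpha sigma s * 'X_(minvar w) : {mpoly K[n.+1]})
                     *: fsymb K ms i (sigma :\ s)
                          (U_(s) + w - U_(minvar w))%MM)
              + \sum_(s in sigma | prec l (U_(s) + w - U_(minvar w))%MM
                                           (v *+ k)%MM)
                  (((-1) ^+ alpha sigma s * 'X_(minvar wt) : {mpoly K[n.+1]})
                     *: fsymb K ms i (sigma :\ s)
                          (U_(s) + w - U_(minvar wt))%MM)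
              - \sum_(s in sigma)
                  (((-1) ^+ alpha sigma s * 'X_s : {mpoly K[n.+1]})
                     *: fsymb K ms i (sigma :\ s) w)]].

Proof.
have u0 : u ord0 != 0%N by rewrite -lep1mP.
have v0 : v ord0 = 0%N by apply/eqP; rewrite -[_ == _]negbK -lep1mP.
have [l [hl a0 vE]] := lexseg_shape hd hu hv u0 v0 hlq hncl.
have uE : u = (U_(ord0) + (u - U_(ord0)))%MM by rewrite [RHS]addmC submK.
exists l; split=> //; first by exists (u - U_(ord0))%MM.
move=> k ms k0 [ms_s ms_J]; have /andP[_ ln] := hl.
have G_deg w : prodset (lexseg u v) k w -> mdeg w = (k * d)%N.
  by apply: prodset_deg; apply: lexseg_deg hu.
have G_hdeg w : prodset (lexseg u v) k w -> (k <= hdeg l w)%N.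
  exact: prodset_hdeg hl vE hu hv k w.
have G_move := @prodset_move n d l u v _ hl a0 uE vE hu hv k.
have mem_ms w : w \in ms <-> prodset (lexseg u v) k w.
  apply: (iff_trans (ms_J w)); apply: (iff_trans (eq_mingen w (ideal_pow_mon _ k))).
  exact: mingen_equigenerated G_deg w.
have JE p : ideal_pow I k p <-> mon_ideal (fun m => m \in ms) p.
  apply: (iff_trans (ideal_pow_mon _ k p)); apply: eq_mon_ideal => w.
  exact: iff_sym (mem_ms w).
have anti := nth_anti G_deg ms_s mem_ms.
have pos a : tnth (in_tuple ms) a != 0%MM.
  rewrite -mdeg_eq0 (mdeg_nth G_deg mem_ms) muln_eq0 negb_or -!lt0n k0.
  exact: ltn_trans hd.
have lq := @nth_lq K _ _ k l _ ms G_deg G_hdeg G_move ms_s mem_ms.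
have reg := @nth_reg K _ _ k l _ ms G_deg G_hdeg G_move ms_s mem_ms.
exists (del K ms); split.
- exact: del_resolution.
- exact: del_mapping_cone.
- move=> w /(memsP ms)[a ->].
  by rewrite (fsymb_fs K anti) (del_fs reg) ?cards0 // psi_kosz_symb0.
move=> i a sigma w wt sA ci.
have wD s t : admissible k l w s t -> mdeg (U_(s) + w - U_(t))%MM = mdeg (v *+ k)%MM.
  case/and3P=> _ w0 _.
  by rewrite mdeg_move // (mdeg_nth G_deg mem_ms) mdegMn hv mulnC.
have V0 j : j != l -> j != ord_max -> (v *+ k)%MM j = 0%N.
  by move=> jl jM; rewrite mulmnE (v_two vE).
(* This exponent turns comparison with v^k into the bound k on the head degree. *)
have Vl : (v *+ k)%MM l = k by rewrite mulmnE (v_l hl vE) mul1n.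
(* The admissible t also ensures that w, and its tail in the second sum, differ from 1, so [minvar]
   never takes its default value. *)
have adm s : s \in sigma -> exists t, admissible k l w s t.
  move=> /(subsetP sA) sP.
  exact: (elimT (lqset_admissible K G_deg G_hdeg G_move ms_s mem_ms a s) sP).
have mdeg_min s : s \in sigma -> mdeg (U_(s) + w - U_(minvar w))%MM = mdeg (v *+ k)%MM.
  case/adm=> t tP; rewrite -(wD s t tP); case/and3P: tP => _ w0 _.
  by have [w1 _] := minvarP w0; rewrite !mdeg_move.
have decE s t : admissible k l w s t ->
    (forall t', admissible k l w s t' -> (t <= t')%N) ->
  tnth (in_tuple ms) (decomp a s) = (U_(s) + w - U_(t))%MM /\ cofac a s = U_(t)%MM.
  move=> tP tmin.
  have e := decomp_min_admissible G_deg G_hdeg G_move ms_s mem_ms tP tmin.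
  split=> //; rewrite /cofac e subm_sub //.
  by case/and3P: tP => _ w0 _; rewrite lep1mP mnmDE addn_eq0 (negPf w0) andbF.
rewrite [fsymb _ _ _ _ w](fsymb_fs K anti i.+1 a sigma).
apply: (etrans (del_fs reg a ci)).
apply: (congr2 (fun x y => x - y)); last first.
  by apply: eq_bigr => s _; rewrite [fsymb _ _ _ _ w](fsymb_fs K anti).
apply: big_split_cond => s sS.
- by rewrite (succeqE ln V0 (mdeg_min s sS)) (precE ln V0 (mdeg_min s sS)) ltnNge.
- rewrite (succeqE ln V0 (mdeg_min s sS)) Vl => hk.
  have [t tP] := adm s sS; have [qP qmin] := admissible_minvar tP hk.
  have [e ->] := decE s _ qP qmin; congr (_ *: _).
  by rewrite -e; apply/esym/(fsymb_fs K anti).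
- rewrite (precE ln V0 (mdeg_min s sS)) Vl => hk.
  have [t tP] := adm s sS; have [qP qmin] := admissible_minvar_tail tP hk.
  have [e ->] := decE s _ qP qmin; congr (_ *: _).
  by rewrite -e; apply/esym/(fsymb_fs K anti).
Qed.
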